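(* Let $\kappa,\tau$ be real numbers with $\tau\ge 0$, and let $M$ be a constant angle surface, with constant angle $\theta$, in the Bianchi-Cartan-Vranceanu space $\widetilde{M}^3(\kappa,\tau)$. Then there is a function $\lambda$ on $M$ such that the following statements hold. (i) With respect to $\{T,JT\}$, the shape operator is given by $$S=\begin{pmatrix}0&-\tau\\-\tau&\lambda\end{pmatrix},$$ i.e. $ST=-\tau JT$ and $S(JT)=-\tau T+\lambda JT$. (ii) The Levi-Civita connection $\nabla$ of the surface is determined by $$\nabla_TT=-2\tau\cos\theta\,JT,\quad \nabla_{JT}T=\lambda\cos\theta\,JT,\quad \nabla_TJT=2\tau\cos\theta\,T,\quad \nabla_{JT}JT=-\lambda\cos\theta\,T.$$ (iii) The Gaussian curvature of the surface is a constant given by $$K=(\kappa-4\tau^2)\cos^2\theta.$$ (iv) The function $\lambda$ satisfies the PDE $$T[\lambda]+\lambda^2\cos\theta+\kappa\cos\theta\sin^2\theta+4\tau^2\cos^3\theta=0.$$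
   Context: For real numbers $\kappa,\tau$ with $\tau\ge0$, the Bianchi-Cartan-Vranceanu space (BCV-space) $\widetilde{M}^3(\kappa,\tau)$ is the set $\{(x,y,z)\in\mathbb{R}^3 : 1+\frac{\kappa}{4}(x^2+y^2)>0\}$ with the metric $$ds^2=\frac{dx^2+dy^2}{(1+\frac{\kappa}{4}(x^2+y^2))^2}+\left(dz+\tau\frac{y\,dx-x\,dy}{1+\frac{\kappa}{4}(x^2+y^2)}\right)^2.$$ An orthonormal frame, taken to be positively oriented, is $e_1=(1+\frac{\kappa}{4}(x^2+y^2))\partial_x-\tau y\,\partial_z$, $e_2=(1+\frac{\kappa}{4}(x^2+y^2))\partial_y+\tau x\,\partial_z$, $e_3=\partial_z$. Let $F:M\to\widetilde{M}^3(\kappa,\tau)$ be an isometric immersion of an oriented surface, $N$ a unit normal vector field, $S$ the associated shape operator ($SX=-\widetilde\nabla_XN$, with $\widetilde\nabla$ the Levi-Civita connection of the ambient space), $\theta$ the angle between $e_3$ and $N$, and $T$ the projection of $e_3$ onto the tangent plane of $M$, i.e. the vector field $T$ on $M$ with $F_*T+\cos\theta\,N=e_3$. For a tangent vector $X$, $JX:=N\times X$ (rotation over $\frac{\pi}{2}$ in the tangent plane of $M$). Working locally, one may assume $\theta\in[0,\frac{\pi}{2}]$. $M$ is called a constant angle surface if $\theta$ is the same at every point. For a vector field $X$ and a function $f$ on $M$, $X[f]$ denotes the derivative of $f$ in the direction of $X$. *)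

(* Defs.v *)
(* Surfaces are abstract smooth 2-manifolds given by an atlas of
   parametrizations chart i : R*R -> M, of which only the restriction to the
   open set dom i matters.  All tensor calculus is done in coordinates. *)
From Stdlib Require Import Reals.
From Coquelicot Require Import Coquelicot.
Open Scope R_scope.

Inductive ix2 : Set := iu | iv.
Inductive ix3 : Set := ix | iy | iz.

Definition vec2 := ix2 -> R.
Definition vec3 := ix3 -> R.

Definition sum2 (f : ix2 -> R) : R := f iu + f iv.
Definition sum3 (f : ix3 -> R) : R := f ix + f iy + f iz.

(* cyclic successor: used for cofactors and for the cross product *)
Definition nxt (i : ix3) : ix3 :=
  match i with ix => iy | iy => iz | iz => ix end.

Definition d2 (a : ix2) (f : R * R -> R) (p : R * R) : R :=
  match a with
  | iu => Derive (fun t => f (t, snd p)) (fst p)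
  | iv => Derive (fun t => f (fst p, t)) (snd p)
  end.

Definition upd (p : vec3) (i : ix3) (t : R) : vec3 := fun j =>
  match i, j with
  | ix, ix | iy, iy | iz, iz => t
  | _, _ => p j
  end.

Definition d3 (i : ix3) (f : vec3 -> R) (p : vec3) : R :=
  Derive (fun t => f (upd p i t)) (p i).

Definition det2 (g : ix2 -> ix2 -> R) : R := g iu iu * g iv iv - g iu iv * g iv iu.

Definition inv2 (g : ix2 -> ix2 -> R) (a b : ix2) : R :=
  match a, b with
  | iu, iu => g iv iv
  | iv, iv => g iu iu
  | _, _ => - g a b
  end / det2 g.

(* no alternating sign: the cyclic order of the indices takes care of it *)
Definition cofactor3 (g : ix3 -> ix3 -> R) (i j : ix3) : R :=
  g (nxt i) (nxt j) * g (nxt (nxt i)) (nxt (nxt j))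
  - g (nxt i) (nxt (nxt j)) * g (nxt (nxt i)) (nxt j).

Definition det3 (g : ix3 -> ix3 -> R) : R := sum3 (fun j => g ix j * cofactor3 g ix j).

Definition inv3 (g : ix3 -> ix3 -> R) (i j : ix3) : R := cofactor3 g j i / det3 g.

(* Christoffel symbols Gamma^k_{ij} of the Levi-Civita connection of g; I is the
   type of indices, P the type of points, d the partial derivatives. *)
Definition christoffel (I P : Type) (sum : (I -> R) -> R)
    (d : I -> (P -> R) -> P -> R) (inv : (I -> I -> R) -> I -> I -> R)
    (g : P -> I -> I -> R) (p : P) (k i j : I) : R :=
  / 2 * sum (fun l => inv (g p) k l *
    (d i (fun q => g q j l) p + d j (fun q => g q i l) p - d l (fun q => g q i j) p)).

Definition bcv_D (kappa : R) (p : vec3) : R := 1 + kappa / 4 * (p ix ^ 2 + p iy ^ 2).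

Definition in_bcv (kappa : R) (p : vec3) : Prop := 0 < bcv_D kappa p.

(* the 1-form dz + tau (y dx - x dy) / D *)
Definition bcv_eta (kappa tau : R) (p : vec3) (i : ix3) : R :=
  match i with
  | ix => tau * p iy / bcv_D kappa p
  | iy => - (tau * p ix / bcv_D kappa p)
  | iz => 1
  end.

Definition bcv_metric (kappa tau : R) (p : vec3) (i j : ix3) : R :=
  match i, j with
  | ix, ix | iy, iy => / bcv_D kappa p ^ 2
  | _, _ => 0
  end + bcv_eta kappa tau p i * bcv_eta kappa tau p j.

Definition bcv_inner (kappa tau : R) (p : vec3) (v w : vec3) : R :=
  sum3 (fun i => sum3 (fun j => bcv_metric kappa tau p i j * v i * w j)).

(* bcv_frame _ _ p ix, iy, iz are e_1, e_2, e_3 *)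
Definition bcv_frame (kappa tau : R) (p : vec3) (a : ix3) : vec3 := fun k =>
  match a, k with
  | ix, ix => bcv_D kappa p
  | ix, iz => - (tau * p iy)
  | iy, iy => bcv_D kappa p
  | iy, iz => tau * p ix
  | iz, iz => 1
  | _, _ => 0
  end.

(* cross product for the orientation in which the orthonormal frame is positive *)
Definition bcv_cross (kappa tau : R) (p : vec3) (v w : vec3) : vec3 := fun k =>
  let comp x a := bcv_inner kappa tau p x (bcv_frame kappa tau p a) in
  sum3 (fun a =>
    (comp v (nxt a) * comp w (nxt (nxt a)) - comp v (nxt (nxt a)) * comp w (nxt a))
    * bcv_frame kappa tau p a k).

Definition bcv_christoffel (kappa tau : R) : vec3 -> ix3 -> ix3 -> ix3 -> R :=
  christoffel ix3 vec3 sum3 d3 inv3 (bcv_metric kappa tau).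

Definition smooth_at (f : R * R -> R) (p : R * R) : Prop :=
  locally p (fun q => forall n, ex_diff_n (fun u v => f (u, v)) n (fst q) (snd q)).

Record surface : Type := {
  carrier :> Type;
  idx : Type;
  dom : idx -> R * R -> Prop;
  chart : idx -> R * R -> carrier;
  dom_open : forall i, open (dom i);
  chart_inj : forall i p q, dom i p -> dom i q -> chart i p = chart i q -> p = q;
  chart_cover : forall x, exists i p, dom i p /\ chart i p = x;
  (* near every point of an overlap there is a smooth orientation-preserving
     change of coordinates; in particular overlaps are open *)
  chart_change : forall i j p q, dom i p -> dom j q -> chart i p = chart j q ->
    exists psi : R * R -> R * R,
      locally p (fun r => dom j (psi r) /\ chart j (psi r) = chart i r) /\
      smooth_at (fun r => fst (psi r)) p /\
      smooth_at (fun r => snd (psi r)) p /\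
      0 < det2 (fun a b => d2 b (fun r => match a with
                                          | iu => fst (psi r)
                                          | iv => snd (psi r)
                                          end) p);
  hausdorff : forall x y, x <> y -> exists i p j q,
    dom i p /\ chart i p = x /\ dom j q /\ chart j q = y /\
    exists A B : R * R -> Prop, locally p A /\ locally q B /\
      forall a b, dom i a -> dom j b -> A a -> B b -> chart i a <> chart j b;
  second_countable : exists s : nat -> idx,
    forall x, exists n p, dom (s n) p /\ chart (s n) p = x
}.

Definition smooth_fun (M : surface) (f : M -> R) : Prop :=
  forall i p, dom M i p -> smooth_at (fun q => f (chart M i q)) p.

(* Components of a vector field in each chart.  No compatibility between charts
   is imposed; it is automatic for fields with a prescribed image under the
   differential of an immersion. *)
Definition tangent_field (M : surface) := idx M -> R * R -> vec2.

Definition in_chart (M : surface) (A : Type) (i : idx M) (h : M -> A) : R * R -> A :=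
  fun q => h (chart M i q).
Arguments in_chart {M A} i h.

(* In what follows f : R * R -> vec3 is a parametrized surface and vector fields
   are given by their components in the parameter domain. *)

(* image of X under the differential of f *)
Definition push (f : R * R -> vec3) (X : R * R -> vec2) (p : R * R) : vec3 :=
  fun k => sum2 (fun a => X p a * d2 a (fun q => f q k) p).

Definition coord (a : ix2) : R * R -> vec2 := fun _ b =>
  match a, b with iu, iu | iv, iv => 1 | _, _ => 0 end.

Definition induced_metric (kappa tau : R) (f : R * R -> vec3) (p : R * R) (a b : ix2) : R :=
  bcv_inner kappa tau (f p) (push f (coord a) p) (push f (coord b) p).

Definition dir_deriv (X : R * R -> vec2) (h : R * R -> R) (p : R * R) : R :=
  sum2 (fun a => X p a * d2 a h p).

(* nabla_X Y for the Levi-Civita connection of a metric g on the parameter domain *)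
Definition lc_conn (g : R * R -> ix2 -> ix2 -> R) (X Y : R * R -> vec2) : R * R -> vec2 :=
  fun p k => dir_deriv X (fun q => Y q k) p
    + sum2 (fun i => sum2 (fun j =>
        christoffel ix2 (R * R) sum2 d2 inv2 g p k i j * X p i * Y p j)).

(* <R(d_u, d_v) d_v, d_u> / det g; the coordinate fields commute *)
Definition gauss_curv (g : R * R -> ix2 -> ix2 -> R) (p : R * R) : R :=
  let nabla := lc_conn g in
  sum2 (fun a => g p a iu *
    (nabla (coord iu) (nabla (coord iv) (coord iv)) p a
     - nabla (coord iv) (nabla (coord iu) (coord iv)) p a)) / det2 (g p).

(* ambient covariant derivative in direction X of a vector field W along f *)
Definition bcv_conn (kappa tau : R) (f : R * R -> vec3) (X : R * R -> vec2)
    (W : R * R -> vec3) (p : R * R) : vec3 := fun k =>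
  dir_deriv X (fun q => W q k) p
  + sum3 (fun i => sum3 (fun j =>
      bcv_christoffel kappa tau (f p) k i j * push f X p i * W p j)).

(* F_*(S X), the shape operator as a vector of the ambient space *)
Definition shape (kappa tau : R) (f W : R * R -> vec3) (X : R * R -> vec2)
    (p : R * R) : vec3 :=
  fun k => - bcv_conn kappa tau f X W p k.

(* F is isometric in the sense that the surface carries the metric induced by F,
   which is induced_metric in each chart. *)
Definition bcv_immersion (kappa : R) (M : surface) (F : M -> vec3) : Prop :=
  (forall x, in_bcv kappa (F x)) /\
  (forall k, smooth_fun M (fun x => F x k)) /\
  (forall i p, dom M i p -> forall X : vec2,
     (forall k, push (in_chart i F) (fun _ => X) p k = 0) -> forall a, X a = 0).

Definition unit_normal (kappa tau : R) (M : surface) (F N : M -> vec3) : Prop :=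
  (forall k, smooth_fun M (fun x => N x k)) /\
  (forall x, bcv_inner kappa tau (F x) (N x) (N x) = 1) /\
  (forall i p, dom M i p -> forall a,
     bcv_inner kappa tau (F (chart M i p)) (N (chart M i p))
       (push (in_chart i F) (coord a) p) = 0).

(* no normalization of the inner product: e_3 and N are unit vectors *)
Definition constant_angle (kappa tau : R) (M : surface) (F N : M -> vec3) (theta : R) : Prop :=
  0 <= theta <= PI / 2 /\
  forall x, bcv_inner kappa tau (F x) (bcv_frame kappa tau (F x) iz) (N x) = cos theta.

Definition is_e3_projection (kappa tau : R) (M : surface) (F N : M -> vec3) (theta : R)
    (T : tangent_field M) : Prop :=
  forall i p, dom M i p -> forall k,
    push (in_chart i F) (T i) p k + cos theta * N (chart M i p) k
    = bcv_frame kappa tau (F (chart M i p)) iz k.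

Definition is_rotation (kappa tau : R) (M : surface) (F N : M -> vec3)
    (X JX : tangent_field M) : Prop :=
  forall i p, dom M i p -> forall k,
    push (in_chart i F) (JX i) p k
    = bcv_cross kappa tau (F (chart M i p)) (N (chart M i p))
        (push (in_chart i F) (X i) p) k.

(* Main.v *)
From Stdlib Require Import Reals Lra IndefiniteDescription.
From Coquelicot Require Import Coquelicot.
Require Import Defs.
Open Scope R_scope.

(** Everything is read in the ambient orthonormal frame [e_1, e_2, e_3], where
    the Levi-Civita connection of the BCV-space takes the simple form
      [nabla_X W = X[w] + frame_rot(X) w],
    with [frame_rot(X)] a skew matrix ([coframe_conn]).  Let [c = cos theta] and
    let [(n_1, n_2, c)] be the components of [N]; then [n_1^2 + n_2^2 = 1 - c^2],
      [T = (- c n_1, - c n_2, 1 - c^2)]  and  [JT = (n_2, - n_1, 0)].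

    Suppose first that [c^2 <> 1].  Since [(n_1, n_2)] has constant length, all
    that its derivatives contain is the 1-form [mu], the differential of the
    azimuth of [N].  After subtracting the connection form of the base and the
    twisting of the fibres, [mu] becomes [nu], and in terms of [nu]
      [S X = (n_2 nu(X) - tau c X_2, - n_1 nu(X) + tau c X_1, tau (X_2 n_1 - X_1 n_2))]
    ([coframe_shape]).  Hence [S JT = - tau T + nu(JT) JT], and the function
    sought is [lambda = nu(JT)]; the symmetry of [S], which comes from
    [nabla_i f_j = nabla_j f_i] ([conn_coord_sym]), forces
    [nu(T) = - tau (1 + c^2)], which is the formula for [S T].
    Taking tangential parts ([lc_conn_tangential_part]) gives
      [nabla_X T = alpha(X) JT]  and  [nabla_X JT = - alpha(X) T],
    where [alpha = c (nu - tau e^3)] and [e^3] is the third component of the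
    coframe ([lc_T], [lc_JT]); this is the connection, since
    [alpha(T) = - 2 tau c] and [alpha(JT) = c lambda].
    The partial differential equation expresses that [mu], being locally the
    differential of a function, is closed: evaluate [d mu = 0] on [(T, JT)]
    ([codazzi]).  The curvature is [- d alpha (T, JT) / (1 - c^2)]
    ([gauss_curv_structure]), so it follows from that equation.

    If [c = 1], then [N = e_3] and [T = JT = 0].  The symmetry of [S] then
    forces [tau = 0] ([tau_zero]): the planes spanned by [e_1] and [e_2] are not
    integrable otherwise.  Everything is trivial with [lambda = 0], except the
    curvature, computed by [gauss_curv_structure] in the frame [e_1, e_2], which
    is now tangent to the surface ([horizontal_curvature]).

    In a chart [lambda] is [<S JT, JT> / (1 - c^2)].  Formed in a chart chosen
    at each point, this defines a function on the surface, which is smooth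
    because the expression is independent of the chart
    ([shape_coef_chart_change]). *)

(** * The ambient connection in the orthonormal frame *)

Definition coframe (kappa tau : R) (p v : vec3) : vec3 := fun a =>
  match a with
  | ix => v ix / bcv_D kappa p
  | iy => v iy / bcv_D kappa p
  | iz => sum3 (fun i => bcv_eta kappa tau p i * v i)
  end.

Definition dot (v w : vec3) : R := sum3 (fun i => v i * w i).

Lemma sum3_ext (f g : ix3 -> R) : (forall i, f i = g i) -> sum3 f = sum3 g.
Proof. intros H. unfold sum3. now rewrite !H. Qed.

(** The coframe is an isometry onto Euclidean space: this turns all metric
    computations below into algebra with [dot]. *)
Lemma bcv_inner_coframe kappa tau p v w : in_bcv kappa p ->
  bcv_inner kappa tau p v w = dot (coframe kappa tau p v) (coframe kappa tau p w).
Proof.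
  unfold in_bcv. intros H. unfold bcv_inner, dot, coframe, sum3, bcv_metric, bcv_eta.
  field. lra.
Qed.

Lemma coframe_frame kappa tau p a b : in_bcv kappa p ->
  coframe kappa tau p (bcv_frame kappa tau p a) b =
  match a, b with ix, ix | iy, iy | iz, iz => 1 | _, _ => 0 end.
Proof.
  unfold in_bcv. intros H.
  destruct a, b; unfold coframe, sum3, bcv_eta, bcv_frame; field; lra.
Qed.

Lemma coframe_inj kappa tau p v w : in_bcv kappa p ->
  (forall a, coframe kappa tau p v a = coframe kappa tau p w a) -> forall k, v k = w k.
Proof.
  unfold in_bcv. intros H E.
  assert (Ex : v ix = w ix).
  { generalize (E ix); unfold coframe. intros e.
    apply (Rmult_eq_reg_r (/ bcv_D kappa p)); auto. apply Rinv_neq_0_compat; lra. }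
  assert (Ey : v iy = w iy).
  { generalize (E iy); unfold coframe. intros e.
    apply (Rmult_eq_reg_r (/ bcv_D kappa p)); auto. apply Rinv_neq_0_compat; lra. }
  assert (Ez : v iz = w iz).
  { generalize (E iz); unfold coframe, sum3, bcv_eta. rewrite Ex, Ey. lra. }
  intros []; auto.
Qed.

Lemma inv3_spec g (v : vec3) m : det3 g <> 0 ->
  sum3 (fun k => g m k * sum3 (fun l => inv3 g k l * v l)) = v m.
Proof.
  intros H. unfold inv3, det3, sum3, cofactor3 in *.
  destruct m; simpl in *; field; assumption.
Qed.

Lemma bcv_det kappa tau p : in_bcv kappa p -> det3 (bcv_metric kappa tau p) = / bcv_D kappa p ^ 4.
Proof.
  unfold in_bcv. intros H. unfold det3, sum3, cofactor3, bcv_metric, bcv_eta. simpl.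
  field. lra.
Qed.

(** [diff_D], [diff_eta] and [diff_coframe] are the derivatives of [bcv_D],
    [bcv_eta] and [coframe] at [p] in the direction [v]. *)
Definition diff_D (kappa : R) (p v : vec3) : R := kappa / 2 * (p ix * v ix + p iy * v iy).

Definition diff_eta (kappa tau : R) (p v : vec3) (j : ix3) : R :=
  match j with
  | ix => tau * v iy / bcv_D kappa p - tau * p iy * diff_D kappa p v / bcv_D kappa p ^ 2
  | iy => - (tau * v ix / bcv_D kappa p - tau * p ix * diff_D kappa p v / bcv_D kappa p ^ 2)
  | iz => 0
  end.

Definition basis3 (i : ix3) : vec3 := fun j =>
  match i, j with ix, ix | iy, iy | iz, iz => 1 | _, _ => 0 end.

Lemma d3_bcv_metric kappa tau p i j l : in_bcv kappa p ->
  d3 i (fun q => bcv_metric kappa tau q j l) p =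
  match j, l with
  | ix, ix | iy, iy => - 2 * diff_D kappa p (basis3 i) / bcv_D kappa p ^ 3
  | _, _ => 0
  end + diff_eta kappa tau p (basis3 i) j * bcv_eta kappa tau p l
      + bcv_eta kappa tau p j * diff_eta kappa tau p (basis3 i) l.
Proof.
  unfold in_bcv, d3. intros H. apply is_derive_unique.
  destruct i, j, l; unfold bcv_metric, bcv_eta, upd, diff_eta, diff_D, basis3, bcv_D in *;
    auto_derive; repeat split; try lra; auto; try (field; lra);
    try (apply Rgt_not_eq; simpl in *; nra).
Qed.

Definition christoffel_map (kappa tau : R) (p v w : vec3) : vec3 := fun k =>
  sum3 (fun i => sum3 (fun j => bcv_christoffel kappa tau p k i j * v i * w j)).

(** The matrix of connection 1-forms of the frame.  The rotation about [e_3] is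
    [om]: the connection form of the base, of curvature [kappa], plus the twisting
    [tau] of the fibres.  The remaining terms are [nabla_X e_3 = tau X x e_3] and
    its skew counterpart. *)
Definition frame_rot (kappa tau : R) (p xi w : vec3) : vec3 := fun a =>
  let om := kappa / 2 * (p ix * xi iy - p iy * xi ix) + tau * xi iz in
  match a with
  | ix => om * w iy + tau * xi iy * w iz
  | iy => - om * w ix - tau * xi ix * w iz
  | iz => tau * (xi ix * w iy - xi iy * w ix)
  end.

Definition diff_coframe (kappa tau : R) (p v w : vec3) : vec3 := fun a =>
  match a with
  | ix => - w ix * diff_D kappa p v / bcv_D kappa p ^ 2
  | iy => - w iy * diff_D kappa p v / bcv_D kappa p ^ 2
  | iz => sum3 (fun j => diff_eta kappa tau p v j * w j)
  end.

(** Lowering the upper index removes the inverse metric, so that only first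
    derivatives of the metric remain. *)
Lemma metric_christoffel kappa tau p v w m : in_bcv kappa p ->
  sum3 (fun k => bcv_metric kappa tau p m k * christoffel_map kappa tau p v w k) =
  sum3 (fun i => sum3 (fun j => / 2 * (
    d3 i (fun q => bcv_metric kappa tau q j m) p + d3 j (fun q => bcv_metric kappa tau q i m) p
    - d3 m (fun q => bcv_metric kappa tau q i j) p) * v i * w j)).
Proof.
  intros H.
  assert (D0 : det3 (bcv_metric kappa tau p) <> 0).
  { rewrite bcv_det; auto. apply Rinv_neq_0_compat, pow_nonzero. unfold in_bcv in H. lra. }
  transitivity (sum3 (fun i => sum3 (fun j => / 2 *
    sum3 (fun k => bcv_metric kappa tau p m k * sum3 (fun l => inv3 (bcv_metric kappa tau p) k l *
      (d3 i (fun q => bcv_metric kappa tau q j l) p + d3 j (fun q => bcv_metric kappa tau q i l) p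
    - d3 l (fun q => bcv_metric kappa tau q i j) p))) * v i * w j))).
  - unfold christoffel_map, bcv_christoffel, christoffel.
    generalize (bcv_metric kappa tau p m) (inv3 (bcv_metric kappa tau p))
      (fun i j l => d3 i (fun q => bcv_metric kappa tau q j l) p).
    intros G I dg. unfold sum3. cbv beta. ring_simplify. unfold sum3. ring.
  - apply sum3_ext. intros i. apply sum3_ext. intros j. do 3 f_equal.
    now rewrite (inv3_spec (bcv_metric kappa tau p) (fun l =>
      d3 i (fun q => bcv_metric kappa tau q j l) p + d3 j (fun q => bcv_metric kappa tau q i l) p
    - d3 l (fun q => bcv_metric kappa tau q i j) p) m).
Qed.

(** The [a]-th component is the inner product with [e_a], hence only the lowered
    Christoffel symbols enter and the identity is a rational one in the
    coordinates.  The term [diff_coframe] cancels against the derivative of the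
    coframe in [coframe_conn]. *)
Lemma coframe_christoffel kappa tau p v w a : in_bcv kappa p ->
  coframe kappa tau p (christoffel_map kappa tau p v w) a =
  diff_coframe kappa tau p v w a +
  frame_rot kappa tau p (coframe kappa tau p v) (coframe kappa tau p w) a.
Proof.
  intros H.
  transitivity (sum3 (fun m => bcv_frame kappa tau p a m *
    sum3 (fun k => bcv_metric kappa tau p m k * christoffel_map kappa tau p v w k))).
  { unfold in_bcv in H. generalize (christoffel_map kappa tau p v w). intros u.
    destruct a; unfold coframe, sum3, bcv_frame, bcv_metric, bcv_eta; field; lra. }
  rewrite (sum3_ext _ _ (fun m => f_equal (fun r => bcv_frame kappa tau p a m * r)
    (metric_christoffel kappa tau p v w m H))).
  unfold sum3.
  rewrite !d3_bcv_metric by assumption.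
  unfold in_bcv in H.
  destruct a; unfold diff_coframe, frame_rot, coframe, bcv_frame, sum3, diff_eta, diff_D, bcv_eta, basis3, bcv_D in *;
   field; lra.
Qed.

Implicit Types (i j l : ix2) (p q : R * R) (h : R * R -> R).
Implicit Types (X Y V : R * R -> vec2) (f W : R * R -> vec3).

(** * Smooth functions of two real variables *)

(** Both partial derivatives are derivatives along [curve], which allows the
    rules of differentiation to be proved for both at once. *)
Definition curve (i : ix2) (p : R * R) (t : R) : R * R :=
  match i with iu => (t, snd p) | iv => (fst p, t) end.
Definition at_ix (i : ix2) (p : R * R) : R :=
  match i with iu => fst p | iv => snd p end.

Lemma d2_curve i h p : d2 i h p = Derive (fun t => h (curve i p t)) (at_ix i p).
Proof. destruct i; reflexivity. Qed.

Lemma curve_at i p : curve i p (at_ix i p) = p.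
Proof. destruct i, p; reflexivity. Qed.

Lemma locally_curve i (p : R * R) (P : R * R -> Prop) :
  locally p P -> locally (at_ix i p) (fun t => P (curve i p t)).
Proof.
  intros [e H]. exists e. intros t Ht. apply H.
  destruct i, p; split; simpl; auto; apply ball_center.
Qed.

Definition ex_d2 (i : ix2) (h : R * R -> R) (p : R * R) : Prop :=
  ex_derive (fun t => h (curve i p t)) (at_ix i p).

Definition diff_upto (n : nat) (h : R * R -> R) (p : R * R) : Prop :=
  ex_diff_n (fun u v => h (u, v)) n (fst p) (snd p).

Definition cont2 (h : R * R -> R) (p : R * R) : Prop :=
  continuity_2d_pt (fun u v => h (u, v)) (fst p) (snd p).

Lemma diff_upto_0 h p : diff_upto 0 h p <-> cont2 h p.
Proof. unfold diff_upto, cont2; simpl; tauto. Qed.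

Lemma diff_upto_S n h p :
  diff_upto (S n) h p <-> cont2 h p /\ (forall i, ex_d2 i h p) /\ (forall i, diff_upto n (d2 i h) p).
Proof.
  unfold diff_upto, cont2, ex_d2. destruct p as [u v]; simpl. split.
  - intros (H1 & H2 & H3 & H4 & H5). repeat split; auto; intros []; assumption.
  - intros (H1 & H2 & H3).
    exact (conj H1 (conj (H2 iu) (conj (H2 iv) (conj (H3 iu) (H3 iv))))).
Qed.

Lemma diff_upto_cont2 n h p : diff_upto n h p -> cont2 h p.
Proof. destruct n; [apply diff_upto_0 | rewrite diff_upto_S; tauto]. Qed.

Lemma diff_upto_pred n h p : diff_upto (S n) h p -> diff_upto n h p.
Proof. apply ex_diff_n_m; auto. Qed.

Lemma locally_pair (P : R * R -> Prop) p :
  locally p P <-> locally_2d (fun u v => P (u, v)) (fst p) (snd p).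
Proof.
  destruct p as [u v]; simpl. rewrite locally_2d_locally.
  split; apply filter_imp; intros [x y]; auto.
Qed.

Lemma diff_upto_ext n h h' p : locally p (fun q => h q = h' q) -> diff_upto n h p -> diff_upto n h' p.
Proof. intros H. apply ex_diff_n_ext_loc. now apply locally_pair in H. Qed.

Lemma d2_ext i h h' p : locally p (fun q => h q = h' q) -> d2 i h p = d2 i h' p.
Proof.
  intros H. rewrite !d2_curve. apply Derive_ext_loc.
  exact (locally_curve i p _ H).
Qed.

Lemma cont2_continuous h p : cont2 h p <-> continuous h p.
Proof.
  destruct p as [u v]; unfold cont2; simpl. rewrite continuity_2d_pt_filterlim.
  split; intros H.
  - intros P HP. specialize (H P HP). unfold filtermap in *.
    revert H. apply filter_imp. intros [x y]; auto.
  - intros P HP. specialize (H P HP). unfold filtermap in *.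
    revert H. apply filter_imp. intros [x y]; auto.
Qed.

Lemma d2_const i c p : d2 i (fun _ => c) p = 0.
Proof. rewrite d2_curve. apply Derive_const. Qed.

Lemma ex_d2_plus i h h' p : ex_d2 i h p -> ex_d2 i h' p -> ex_d2 i (fun q => h q + h' q) p.
Proof. intros; exact (ex_derive_plus _ _ _ H H0). Qed.

Lemma ex_d2_mult i h h' p : ex_d2 i h p -> ex_d2 i h' p -> ex_d2 i (fun q => h q * h' q) p.
Proof. intros; exact (ex_derive_mult _ _ _ H H0). Qed.

Lemma ex_d2_inv i h p : ex_d2 i h p -> h p <> 0 -> ex_d2 i (fun q => / h q) p.
Proof. intros; apply (ex_derive_inv _ _ H). now rewrite curve_at. Qed.

Lemma d2_plus_ex i h h' p : ex_d2 i h p -> ex_d2 i h' p ->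
  d2 i (fun q => h q + h' q) p = d2 i h p + d2 i h' p.
Proof. intros; rewrite !d2_curve; exact (Derive_plus _ _ _ H H0). Qed.

Lemma d2_mult_ex i h h' p : ex_d2 i h p -> ex_d2 i h' p ->
  d2 i (fun q => h q * h' q) p = d2 i h p * h' p + h p * d2 i h' p.
Proof.
  intros; rewrite !d2_curve. etransitivity; [exact (Derive_mult _ _ _ H H0)|].
  simpl. now rewrite curve_at.
Qed.

Lemma d2_inv_ex i h p : ex_d2 i h p -> h p <> 0 ->
  d2 i (fun q => / h q) p = - d2 i h p * (/ h p * / h p).
Proof.
  intros H H0; rewrite !d2_curve. etransitivity; [apply (Derive_inv _ _ H); now rewrite curve_at|].
  simpl. rewrite curve_at. field. auto.
Qed.

(** Smoothness at a point requires one neighbourhood for all orders.  Induction on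
    the order is therefore done on a fixed open set. *)
Definition smooth_n_on (A : R * R -> Prop) n h := forall p, A p -> diff_upto n h p.

Lemma smooth_n_on_const A n c : smooth_n_on A n (fun _ => c).
Proof.
  revert c; induction n; intros c p Hp.
  - apply diff_upto_0. apply cont2_continuous, continuous_const.
  - apply diff_upto_S. repeat split.
    + apply cont2_continuous, continuous_const.
    + intros i. exact (ex_derive_const c _).
    + intros i. apply (diff_upto_ext _ (fun _ => 0)).
      * apply filter_forall. intros q. now rewrite d2_const.
      * exact (IHn 0 p Hp).
Qed.

Lemma smooth_n_on_plus A n h h' : open A ->
  smooth_n_on A n h -> smooth_n_on A n h' -> smooth_n_on A n (fun q => h q + h' q).
Proof.
  intros HA; revert h h'; induction n; intros h h' Hf Hg p Hp.
  - apply diff_upto_0, continuity_2d_pt_plus;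
      apply (diff_upto_cont2 0); [apply Hf | apply Hg]; auto.
  - apply diff_upto_S.
    destruct (proj1 (diff_upto_S _ _ _) (Hf p Hp)) as (F1 & F2 & F3).
    destruct (proj1 (diff_upto_S _ _ _) (Hg p Hp)) as (G1 & G2 & G3).
    repeat split.
    + now apply continuity_2d_pt_plus.
    + intros i; now apply ex_d2_plus.
    + intros i. apply (diff_upto_ext _ (fun q => d2 i h q + d2 i h' q)).
      * generalize (HA p Hp). apply filter_imp. intros q Hq. symmetry. apply d2_plus_ex.
        -- now apply (proj1 (diff_upto_S _ _ _) (Hf q Hq)).
        -- now apply (proj1 (diff_upto_S _ _ _) (Hg q Hq)).
      * apply IHn; auto; intros q Hq.
        -- now apply (proj1 (diff_upto_S _ _ _) (Hf q Hq)).
        -- now apply (proj1 (diff_upto_S _ _ _) (Hg q Hq)).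
Qed.

Lemma smooth_n_on_mult A n h h' : open A ->
  smooth_n_on A n h -> smooth_n_on A n h' -> smooth_n_on A n (fun q => h q * h' q).
Proof.
  intros HA; revert h h'; induction n; intros h h' Hf Hg p Hp.
  - apply diff_upto_0, continuity_2d_pt_mult;
      apply (diff_upto_cont2 0); [apply Hf | apply Hg]; auto.
  - apply diff_upto_S.
    destruct (proj1 (diff_upto_S _ _ _) (Hf p Hp)) as (F1 & F2 & F3).
    destruct (proj1 (diff_upto_S _ _ _) (Hg p Hp)) as (G1 & G2 & G3).
    repeat split.
    + now apply continuity_2d_pt_mult.
    + intros i; now apply ex_d2_mult.
    + intros i. apply (diff_upto_ext _ (fun q => d2 i h q * h' q + h q * d2 i h' q)).
      * generalize (HA p Hp). apply filter_imp. intros q Hq. symmetry. apply d2_mult_ex.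
        -- now apply (proj1 (diff_upto_S _ _ _) (Hf q Hq)).
        -- now apply (proj1 (diff_upto_S _ _ _) (Hg q Hq)).
      * apply smooth_n_on_plus with (A := A); auto; apply IHn; intros q Hq.
        -- now apply (proj1 (diff_upto_S _ _ _) (Hf q Hq)).
        -- now apply diff_upto_pred, Hg.
        -- now apply diff_upto_pred, Hf.
        -- now apply (proj1 (diff_upto_S _ _ _) (Hg q Hq)).
Qed.

Lemma smooth_n_on_inv A n h : open A -> (forall q, A q -> h q <> 0) ->
  smooth_n_on A n h -> smooth_n_on A n (fun q => / h q).
Proof.
  intros HA H0; induction n; intros Hf p Hp.
  - apply diff_upto_0, cont2_continuous. apply (continuous_comp h Rinv).
    + apply cont2_continuous, (diff_upto_cont2 0); auto.
    + apply continuous_Rinv; auto.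
  - apply diff_upto_S.
    destruct (proj1 (diff_upto_S _ _ _) (Hf p Hp)) as (F1 & F2 & F3).
    assert (Hi : smooth_n_on A n (fun q => / h q)).
    { apply IHn. intros q Hq. now apply diff_upto_pred, Hf. }
    repeat split.
    + apply (diff_upto_cont2 n), Hi, Hp.
    + intros i; apply ex_d2_inv; auto.
    + intros i. apply (diff_upto_ext _ (fun q => (-1 * d2 i h q) * (/ h q * / h q))).
      * generalize (HA p Hp). apply filter_imp. intros q Hq. symmetry.
        rewrite d2_inv_ex; auto; [ring|].
        now apply (proj1 (diff_upto_S _ _ _) (Hf q Hq)).
      * apply smooth_n_on_mult with (A := A); auto; apply smooth_n_on_mult; auto.
        -- apply smooth_n_on_const.
        -- intros q Hq. now apply (proj1 (diff_upto_S _ _ _) (Hf q Hq)).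
Qed.

Lemma smooth_at_on h p : smooth_at h p <->
  exists A, open A /\ A p /\ forall n, smooth_n_on A n h.
Proof.
  split.
  - intros H. exists (fun q => locally q (fun r => forall n, diff_upto n h r)). repeat split.
    + intros q Hq. now apply locally_locally.
    + exact H.
    + intros n q Hq. exact (locally_singleton _ _ Hq n).
  - intros (A & HA & Hp & Hf). unfold smooth_at. generalize (HA p Hp). apply filter_imp.
    intros q Hq n. exact (Hf n q Hq).
Qed.

Lemma smooth_at_near h p : smooth_at h p -> locally p (smooth_at h).
Proof. apply locally_locally. Qed.

Lemma smooth_at_ext h h' p : locally p (fun q => h q = h' q) -> smooth_at h p -> smooth_at h' p.
Proof.
  intros H Hf. apply locally_locally in H. unfold smooth_at in *.
  generalize (filter_and _ _ H Hf). apply filter_imp.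
  intros q [H1 H2] n. exact (diff_upto_ext n h h' q H1 (H2 n)).
Qed.

Lemma smooth_at_const c p : smooth_at (fun _ => c) p.
Proof. unfold smooth_at. apply filter_forall. intros q n. apply (smooth_n_on_const (fun _ => True) n c q I). Qed.

Lemma smooth_at_plus h h' p : smooth_at h p -> smooth_at h' p -> smooth_at (fun q => h q + h' q) p.
Proof.
  intros F G. apply smooth_at_on in F, G. apply smooth_at_on.
  destruct F as (A & HA & Ap & Hf), G as (B & HB & Bp & Hg).
  exists (fun q => A q /\ B q). repeat split; auto.
  - now apply open_and.
  - intros n. apply smooth_n_on_plus; [now apply open_and | |].
    + intros q [Hq _]. now apply Hf.
    + intros q [_ Hq]. now apply Hg.
Qed.

Lemma smooth_at_mult h h' p : smooth_at h p -> smooth_at h' p -> smooth_at (fun q => h q * h' q) p.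
Proof.
  intros F G. apply smooth_at_on in F, G. apply smooth_at_on.
  destruct F as (A & HA & Ap & Hf), G as (B & HB & Bp & Hg).
  exists (fun q => A q /\ B q). repeat split; auto.
  - now apply open_and.
  - intros n. apply smooth_n_on_mult; [now apply open_and | |].
    + intros q [Hq _]. now apply Hf.
    + intros q [_ Hq]. now apply Hg.
Qed.

Lemma smooth_at_opp h p : smooth_at h p -> smooth_at (fun q => - h q) p.
Proof.
  intros H. apply smooth_at_ext with (fun q => -1 * h q).
  - apply filter_forall. intros; ring.
  - apply smooth_at_mult; auto. apply smooth_at_const.
Qed.

Lemma smooth_at_minus h h' p : smooth_at h p -> smooth_at h' p -> smooth_at (fun q => h q - h' q) p.
Proof. intros Hf Hg. exact (smooth_at_plus _ _ _ Hf (smooth_at_opp _ _ Hg)). Qed.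

Lemma smooth_at_cont h p : smooth_at h p -> continuous h p.
Proof.
  intros H. apply cont2_continuous. apply (diff_upto_cont2 0). exact (locally_singleton _ _ H 0%nat).
Qed.

Lemma smooth_at_neq0 h p : smooth_at h p -> h p <> 0 -> locally p (fun q => h q <> 0).
Proof.
  intros H H0. apply smooth_at_cont, cont2_continuous in H.
  apply locally_pair. destruct p. now apply continuity_2d_pt_neq_0.
Qed.

Lemma smooth_at_inv h p : smooth_at h p -> h p <> 0 -> smooth_at (fun q => / h q) p.
Proof.
  intros Hf H0. assert (L := smooth_at_neq0 h p Hf H0).
  apply smooth_at_on in Hf. apply smooth_at_on. destruct Hf as (A & HA & Ap & Hf).
  exists (fun q => A q /\ locally q (fun r => h r <> 0)).
  assert (O : open (fun q => A q /\ locally q (fun r => h r <> 0))).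
  { apply open_and; auto. intros q Hq. now apply locally_locally. }
  repeat split; auto.
  intros n. apply smooth_n_on_inv; auto.
  - intros q [_ Hq]. exact (locally_singleton _ _ Hq).
  - intros q [Hq _]. now apply Hf.
Qed.

Lemma smooth_at_div h h' p : smooth_at h p -> smooth_at h' p -> h' p <> 0 ->
  smooth_at (fun q => h q / h' q) p.
Proof. intros. apply smooth_at_mult; auto. now apply smooth_at_inv. Qed.

Lemma smooth_at_pow h n p : smooth_at h p -> smooth_at (fun q => h q ^ n) p.
Proof.
  intros H; induction n; simpl.
  - apply smooth_at_const.
  - now apply smooth_at_mult.
Qed.

Lemma smooth_at_d2 i h p : smooth_at h p -> smooth_at (d2 i h) p.
Proof.
  unfold smooth_at. apply filter_imp. intros q H n. now apply (proj1 (diff_upto_S n h q) (H (S n))).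
Qed.

Lemma smooth_at_ex_d2 i h p : smooth_at h p -> ex_d2 i h p.
Proof.
  intros H. now apply (proj1 (diff_upto_S 0 h p) (locally_singleton _ _ H 1%nat)).
Qed.

Lemma d2_plus i h h' p : smooth_at h p -> smooth_at h' p ->
  d2 i (fun q => h q + h' q) p = d2 i h p + d2 i h' p.
Proof. intros; apply d2_plus_ex; now apply smooth_at_ex_d2. Qed.

Lemma d2_mult i h h' p : smooth_at h p -> smooth_at h' p ->
  d2 i (fun q => h q * h' q) p = d2 i h p * h' p + h p * d2 i h' p.
Proof. intros; apply d2_mult_ex; now apply smooth_at_ex_d2. Qed.

Lemma d2_opp i h p : d2 i (fun q => - h q) p = - d2 i h p.
Proof. rewrite !d2_curve. apply Derive_opp. Qed.

Lemma d2_minus i h h' p : smooth_at h p -> smooth_at h' p ->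
  d2 i (fun q => h q - h' q) p = d2 i h p - d2 i h' p.
Proof.
  intros. unfold Rminus. rewrite d2_plus, d2_opp; auto. now apply smooth_at_opp.
Qed.

Lemma d2_inv i h p : smooth_at h p -> h p <> 0 ->
  d2 i (fun q => / h q) p = - d2 i h p / h p ^ 2.
Proof.
  intros; rewrite d2_inv_ex; auto; [now field|now apply smooth_at_ex_d2].
Qed.

Lemma d2_comm i j h p : smooth_at h p -> d2 i (d2 j h) p = d2 j (d2 i h) p.
Proof.
  intros H.
  enough (d2 iu (d2 iv h) p = d2 iv (d2 iu h) p) by (destruct i, j; auto).
  destruct p as [u v].
  refine (Schwarz (fun u v => h (u, v)) u v _ _ _).
  - apply smooth_at_near in H. apply locally_pair in H. simpl in H. revert H.
    apply locally_2d_impl, locally_2d_forall. intros x y H.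
    exact (conj (smooth_at_ex_d2 iu _ _ H) (conj (smooth_at_ex_d2 iv _ _ H)
     (conj (smooth_at_ex_d2 iu _ _ (smooth_at_d2 iv _ _ H))
           (smooth_at_ex_d2 iv _ _ (smooth_at_d2 iu _ _ H))))).
  - exact (proj2 (cont2_continuous _ _) (smooth_at_cont _ _ (smooth_at_d2 iu _ _ (smooth_at_d2 iv _ _ H)))).
  - exact (proj2 (cont2_continuous _ _) (smooth_at_cont _ _ (smooth_at_d2 iv _ _ (smooth_at_d2 iu _ _ H)))).
Qed.

Lemma smooth_at_differentiable h p : smooth_at h p ->
  differentiable_pt_lim (fun u v => h (u, v)) (fst p) (snd p) (d2 iu h p) (d2 iv h p).
Proof.
  intros H. destruct p as [x y]. simpl.
  apply filterdiff_differentiable_pt_lim.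
  apply (is_derive_filterdiff (fun u v => h (u, v)) x y (fun u v => d2 iu h (u, v)) (d2 iv h (x, y))).
  - generalize (smooth_at_near _ _ H). apply filter_imp. intros [u v] Hq. simpl.
    apply Derive_correct. exact (smooth_at_ex_d2 iu _ _ Hq).
  - apply Derive_correct. exact (smooth_at_ex_d2 iv _ _ H).
  - apply (continuous_ext (d2 iu h)); [intros []; reflexivity|].
    now apply smooth_at_cont, smooth_at_d2.
Qed.

Lemma d2_comp i h (psi : R * R -> R * R) p :
  smooth_at (fun r => fst (psi r)) p -> smooth_at (fun r => snd (psi r)) p ->
  smooth_at h (psi p) ->
  d2 i (fun r => h (psi r)) p =
  d2 iu h (psi p) * d2 i (fun r => fst (psi r)) p + d2 iv h (psi p) * d2 i (fun r => snd (psi r)) p.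
Proof.
  intros H1 H2 Hh.
  generalize (differentiable_pt_lim_comp (fun u v => h (u, v)) (fun u v => fst (psi (u, v)))
    (fun u v => snd (psi (u, v))) (fst p) (snd p)
    (d2 iu h (psi p)) (d2 iv h (psi p))
    (d2 iu (fun r => fst (psi r)) p) (d2 iv (fun r => fst (psi r)) p)
    (d2 iu (fun r => snd (psi r)) p) (d2 iv (fun r => snd (psi r)) p)).
  intros H. destruct p as [u v]. simpl in *.
  specialize (H (smooth_at_differentiable _ _ Hh) (smooth_at_differentiable _ _ H1)
    (smooth_at_differentiable _ _ H2)).
  destruct (differentiable_pt_lim_unique _ _ _ _ _ H) as [E1 E2].
  assert (E : forall q, h (fst (psi q), snd (psi q)) = h (psi q)).
  { intros q. now rewrite <- surjective_pairing. }
  destruct i.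
  - etransitivity; [| exact E1]. unfold d2 at 1. simpl. apply Derive_ext. intros t. now rewrite E.
  - etransitivity; [| exact E2]. unfold d2 at 1. simpl. apply Derive_ext. intros t. now rewrite E.
Qed.

(** * Derivatives along a parametrized surface *)

Lemma dir_deriv_ext X h1 h2 p : locally p (fun q => h1 q = h2 q) -> dir_deriv X h1 p = dir_deriv X h2 p.
Proof. intros H. unfold dir_deriv, sum2. now rewrite !(d2_ext _ _ _ _ H). Qed.

Lemma dir_deriv_coord i h p : dir_deriv (coord i) h p = d2 i h p.
Proof. destruct i; unfold dir_deriv, sum2, coord; ring. Qed.

Lemma dir_deriv_const X c p : dir_deriv X (fun _ => c) p = 0.
Proof. unfold dir_deriv, sum2. rewrite !d2_const. ring. Qed.

Lemma dir_deriv_plus X h1 h2 p : smooth_at h1 p -> smooth_at h2 p ->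
  dir_deriv X (fun q => h1 q + h2 q) p = dir_deriv X h1 p + dir_deriv X h2 p.
Proof. intros. unfold dir_deriv, sum2. rewrite !d2_plus; auto. ring. Qed.

Lemma dir_deriv_minus X h1 h2 p : smooth_at h1 p -> smooth_at h2 p ->
  dir_deriv X (fun q => h1 q - h2 q) p = dir_deriv X h1 p - dir_deriv X h2 p.
Proof. intros. unfold dir_deriv, sum2. rewrite !d2_minus; auto. ring. Qed.

Lemma dir_deriv_opp X h p : dir_deriv X (fun q => - h q) p = - dir_deriv X h p.
Proof. unfold dir_deriv, sum2. rewrite !d2_opp. ring. Qed.

Lemma dir_deriv_mult X h1 h2 p : smooth_at h1 p -> smooth_at h2 p ->
  dir_deriv X (fun q => h1 q * h2 q) p = dir_deriv X h1 p * h2 p + h1 p * dir_deriv X h2 p.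
Proof. intros. unfold dir_deriv, sum2. rewrite !d2_mult; auto. ring. Qed.

Lemma dir_deriv_inv X h p : smooth_at h p -> h p <> 0 ->
  dir_deriv X (fun q => / h q) p = - dir_deriv X h p / h p ^ 2.
Proof. intros. unfold dir_deriv, sum2. rewrite !d2_inv; auto. now field. Qed.

Lemma push_dir f X p k : push f X p k = dir_deriv X (fun q => f q k) p.
Proof. reflexivity. Qed.

Lemma push_coord f i p k : push f (coord i) p k = d2 i (fun q => f q k) p.
Proof. exact (dir_deriv_coord i (fun q => f q k) p). Qed.

Lemma push_sum f X p k :
  push f X p k = sum2 (fun i => X p i * push f (coord i) p k).
Proof. unfold sum2. rewrite !push_coord. reflexivity. Qed.

(* Known smoothness is tried before the structural rules: these would otherwise
   unfold a function such as a component of [coframe] and split it further. *)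
Ltac smooth := repeat first [assumption | solve [auto] | apply smooth_at_const | apply smooth_at_plus
  | apply smooth_at_minus | apply smooth_at_opp | apply smooth_at_mult | apply smooth_at_pow
  | apply smooth_at_div | apply smooth_at_inv | apply smooth_at_d2].

Section Along.
Variables (kappa tau : R) (f : R * R -> vec3) (p : R * R).
Hypothesis Hf : forall k, smooth_at (fun q => f q k) p.
Hypothesis HD : in_bcv kappa (f p).

Lemma smooth_bcv_D : smooth_at (fun q => bcv_D kappa (f q)) p.
Proof. unfold bcv_D. smooth. Qed.

Lemma bcv_D_neq0 : bcv_D kappa (f p) <> 0.
Proof. unfold in_bcv in HD. lra. Qed.

Lemma dir_deriv_bcv_D X : dir_deriv X (fun q => bcv_D kappa (f q)) p = diff_D kappa (f p) (push f X p).
Proof.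
  unfold bcv_D. simpl.
  rewrite dir_deriv_plus, dir_deriv_const, dir_deriv_mult, dir_deriv_const, dir_deriv_plus,
    !dir_deriv_mult, !dir_deriv_const; smooth.
  unfold diff_D. rewrite !push_dir. field.
Qed.

Lemma smooth_bcv_eta k : smooth_at (fun q => bcv_eta kappa tau (f q) k) p.
Proof.
  assert (H1 := smooth_bcv_D). assert (H2 := bcv_D_neq0).
  destruct k; unfold bcv_eta; smooth.
Qed.

Lemma dir_deriv_bcv_eta X k :
  dir_deriv X (fun q => bcv_eta kappa tau (f q) k) p = diff_eta kappa tau (f p) (push f X p) k.
Proof.
  assert (H1 := smooth_bcv_D). assert (H2 := bcv_D_neq0).
  assert (Hi : smooth_at (fun q => / bcv_D kappa (f q)) p) by smooth.
  destruct k; unfold bcv_eta, diff_eta, Rdiv.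
  - rewrite dir_deriv_mult, dir_deriv_mult, dir_deriv_const, dir_deriv_inv, dir_deriv_bcv_D; smooth.
    rewrite !push_dir. field. auto.
  - rewrite dir_deriv_opp, dir_deriv_mult, dir_deriv_mult, dir_deriv_const, dir_deriv_inv, dir_deriv_bcv_D; smooth.
    rewrite !push_dir. field. auto.
  - apply dir_deriv_const.
Qed.

Lemma smooth_coframe W a : (forall k, smooth_at (fun q => W q k) p) ->
  smooth_at (fun q => coframe kappa tau (f q) (W q) a) p.
Proof.
  intros HW. assert (H1 := smooth_bcv_D). assert (H2 := bcv_D_neq0).
  assert (H3 := smooth_bcv_eta).
  destruct a; unfold coframe, sum3; smooth.
Qed.

Lemma dir_deriv_coframe X W a : (forall k, smooth_at (fun q => W q k) p) ->
  dir_deriv X (fun q => coframe kappa tau (f q) (W q) a) p =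
  coframe kappa tau (f p) (fun k => dir_deriv X (fun q => W q k) p) a
  + diff_coframe kappa tau (f p) (push f X p) (W p) a.
Proof.
  intros HW. assert (H1 := smooth_bcv_D). assert (H2 := bcv_D_neq0).
  assert (H3 := smooth_bcv_eta).
  assert (Hi : smooth_at (fun q => / bcv_D kappa (f q)) p) by smooth.
  destruct a; unfold coframe, diff_coframe, sum3, Rdiv.
  - rewrite dir_deriv_mult, dir_deriv_inv, dir_deriv_bcv_D; smooth. field. auto.
  - rewrite dir_deriv_mult, dir_deriv_inv, dir_deriv_bcv_D; smooth. field. auto.
  - rewrite !dir_deriv_plus, !dir_deriv_mult, !dir_deriv_bcv_eta; smooth. ring.
Qed.

Lemma coframe_plus v w a :
  coframe kappa tau (f p) (fun k => v k + w k) a = coframe kappa tau (f p) v a + coframe kappa tau (f p) w a.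
Proof. destruct a; unfold coframe, sum3, Rdiv; ring. Qed.

Lemma coframe_scal c v a :
  coframe kappa tau (f p) (fun k => c * v k) a = c * coframe kappa tau (f p) v a.
Proof. destruct a; unfold coframe, sum3, Rdiv; ring. Qed.

(** Differentiating the components of [W] differentiates the coframe as well; that
    contribution cancels the non-skew part of the Christoffel symbols. *)
Lemma coframe_conn X W a : (forall k, smooth_at (fun q => W q k) p) ->
  coframe kappa tau (f p) (bcv_conn kappa tau f X W p) a =
  dir_deriv X (fun q => coframe kappa tau (f q) (W q) a) p +
  frame_rot kappa tau (f p) (coframe kappa tau (f p) (push f X p)) (coframe kappa tau (f p) (W p)) a.
Proof.
  intros HW. rewrite dir_deriv_coframe; auto.
  etransitivity; [apply (coframe_plus (fun k => dir_deriv X (fun q => W q k) p)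
     (christoffel_map kappa tau (f p) (push f X p) (W p)))|].
  rewrite coframe_christoffel; auto. ring.
Qed.

(** Metric compatibility, because [frame_rot] is skew. *)
Lemma conn_inner X W1 W2 : (forall k, smooth_at (fun q => W1 q k) p) ->
  (forall k, smooth_at (fun q => W2 q k) p) -> locally p (fun q => in_bcv kappa (f q)) ->
  dir_deriv X (fun q => bcv_inner kappa tau (f q) (W1 q) (W2 q)) p =
  bcv_inner kappa tau (f p) (bcv_conn kappa tau f X W1 p) (W2 p)
  + bcv_inner kappa tau (f p) (W1 p) (bcv_conn kappa tau f X W2 p).
Proof.
  intros H1 H2 HL. rewrite !bcv_inner_coframe by assumption.
  rewrite (dir_deriv_ext X (fun q => bcv_inner kappa tau (f q) (W1 q) (W2 q))
    (fun q => dot (coframe kappa tau (f q) (W1 q)) (coframe kappa tau (f q) (W2 q)))).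
  2:{ generalize HL. apply filter_imp. intros q Hq. apply bcv_inner_coframe, Hq. }
  assert (S1 := fun a => smooth_coframe W1 a H1). assert (S2 := fun a => smooth_coframe W2 a H2).
  unfold dot, sum3. rewrite !dir_deriv_plus, !dir_deriv_mult; smooth.
  rewrite !coframe_conn; auto. unfold frame_rot. ring.
Qed.

Lemma dir_deriv_x X : dir_deriv X (fun q => f q ix) p =
  bcv_D kappa (f p) * coframe kappa tau (f p) (push f X p) ix.
Proof. assert (N := bcv_D_neq0). rewrite <- push_dir. unfold coframe. field. auto. Qed.

Lemma dir_deriv_y X : dir_deriv X (fun q => f q iy) p =
  bcv_D kappa (f p) * coframe kappa tau (f p) (push f X p) iy.
Proof. assert (N := bcv_D_neq0). rewrite <- push_dir. unfold coframe. field. auto. Qed.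

Lemma bcv_christoffel_sym k a b :
  bcv_christoffel kappa tau (f p) k a b = bcv_christoffel kappa tau (f p) k b a.
Proof.
  unfold bcv_christoffel, christoffel. f_equal. apply sum3_ext. intros m. f_equal.
  rewrite !d3_bcv_metric by assumption. destruct a, b; ring.
Qed.

(** The ambient connection is torsion-free and the coordinate fields commute.  This
    is the source of both the symmetry of the shape operator and the Gauss
    formula. *)
Lemma conn_coord_sym i j k :
  bcv_conn kappa tau f (coord i) (push f (coord j)) p k =
  bcv_conn kappa tau f (coord j) (push f (coord i)) p k.
Proof.
  unfold bcv_conn. f_equal.
  - rewrite !dir_deriv_coord.
    rewrite (d2_ext i (fun q => push f (coord j) q k) (d2 j (fun q => f q k)))
      by (apply filter_forall; intros; apply push_coord).
    rewrite (d2_ext j (fun q => push f (coord i) q k) (d2 i (fun q => f q k)))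
      by (apply filter_forall; intros; apply push_coord).
    apply d2_comm. auto.
  - unfold sum3.
    rewrite (bcv_christoffel_sym k iy ix), (bcv_christoffel_sym k iz ix), (bcv_christoffel_sym k iz iy).
    ring.
Qed.

Lemma smooth_push Y k : (forall i, smooth_at (fun q => Y q i) p) ->
  smooth_at (fun q => push f Y q k) p.
Proof. intros H. unfold push, sum2. smooth. Qed.

Lemma smooth_coord i j : smooth_at (fun q => coord i q j) p.
Proof. destruct i, j; exact (smooth_at_const _ p). Qed.

Lemma conn_push X Y k : (forall i, smooth_at (fun q => Y q i) p) ->
  bcv_conn kappa tau f X (push f Y) p k =
  sum2 (fun j => dir_deriv X (fun q => Y q j) p * push f (coord j) p k)
  + sum2 (fun i => sum2 (fun j => X p i * Y p j *
      bcv_conn kappa tau f (coord i) (push f (coord j)) p k)).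
Proof.
  intros HY. unfold bcv_conn at 1.
  rewrite (dir_deriv_ext X (fun q => push f Y q k)
    (fun q => Y q iu * d2 iu (fun r => f r k) q + Y q iv * d2 iv (fun r => f r k) q))
    by (apply filter_forall; reflexivity).
  rewrite dir_deriv_plus, !dir_deriv_mult; smooth.
  unfold bcv_conn, sum2. rewrite !dir_deriv_coord.
  assert (E : forall i j, d2 i (fun q => push f (coord j) q k) p = d2 i (d2 j (fun q => f q k)) p).
  { intros i j. apply d2_ext, filter_forall. intros; apply push_coord. }
  rewrite !E. unfold dir_deriv, sum2, sum3.
  rewrite !(push_sum f X), !(push_sum f Y). unfold sum2.
  rewrite !push_coord. ring.
Qed.

Lemma conn_dir X W k :
  bcv_conn kappa tau f X W p k = sum2 (fun i => X p i * bcv_conn kappa tau f (coord i) W p k).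
Proof.
  unfold bcv_conn, sum2, sum3. rewrite !dir_deriv_coord, !(push_sum f X). unfold dir_deriv, sum2. ring.
Qed.
End Along.

Lemma inner_sym kappa tau x v w : bcv_inner kappa tau x v w = bcv_inner kappa tau x w v.
Proof. unfold bcv_inner, sum3, bcv_metric. ring. Qed.

(** * The induced Levi-Civita connection *)

Definition immersed_at (kappa : R) f p : Prop :=
  in_bcv kappa (f p) /\ (forall k, smooth_at (fun q => f q k) p) /\
  (forall x : vec2, (forall k, push f (fun _ => x) p k = 0) -> forall a, x a = 0).

Definition immersed_near (kappa : R) f p : Prop := locally p (immersed_at kappa f).

Lemma immersed_near_at kappa f p : immersed_near kappa f p -> immersed_at kappa f p.
Proof. apply locally_singleton. Qed.

Lemma immersed_near_near kappa f p : immersed_near kappa f p -> locally p (immersed_near kappa f).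
Proof. apply locally_locally. Qed.

Lemma immersed_near_bcv kappa f p : immersed_near kappa f p -> locally p (fun q => in_bcv kappa (f q)).
Proof. unfold immersed_near. apply filter_imp. now intros q [H _]. Qed.

Section Immersion.
Variables (kappa tau : R) (f : R * R -> vec3) (p : R * R).
Hypothesis Hn : immersed_near kappa f p.
Let HD : in_bcv kappa (f p) := proj1 (immersed_near_at _ _ _ Hn).
Let Hf : forall k, smooth_at (fun q => f q k) p := proj1 (proj2 (immersed_near_at _ _ _ Hn)).
Notation g := (induced_metric kappa tau f).

Lemma induced_metric_sym i j : g p i j = g p j i.
Proof. apply inner_sym. Qed.

Lemma induced_metric_sym_near : locally p (fun q => forall i j, g q i j = g q j i).
Proof. apply filter_forall. intros. apply inner_sym. Qed.

Lemma inner_push v x : bcv_inner kappa tau (f p) v (push f x p) =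
  sum2 (fun i => x p i * bcv_inner kappa tau (f p) v (push f (coord i) p)).
Proof.
  unfold bcv_inner, sum3. rewrite !(push_sum f x). unfold sum2. ring.
Qed.

Lemma inner_push_push X Y : bcv_inner kappa tau (f p) (push f X p) (push f Y p) =
  sum2 (fun i => sum2 (fun j => X p i * Y p j * g p i j)).
Proof.
  rewrite (inner_push _ Y). unfold sum2.
  rewrite (inner_sym _ _ _ _ (push f (coord iu) p)), (inner_sym _ _ _ _ (push f (coord iv) p)).
  rewrite !(inner_push _ X). unfold sum2.
  change (bcv_inner kappa tau (f p) (push f (coord ?a) p) (push f (coord ?b) p)) with (g p a b).
  rewrite (induced_metric_sym iv iu). ring.
Qed.

Lemma inner_self_0 v : bcv_inner kappa tau (f p) v v = 0 -> forall k, v k = 0.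
Proof.
  rewrite bcv_inner_coframe by assumption. unfold dot, sum3. intros H.
  apply (coframe_inj kappa tau (f p)); auto.
  assert (Z : forall a, coframe kappa tau (f p) (fun _ => 0) a = 0).
  { intros []; unfold coframe, sum3, Rdiv; ring. }
  intros a. rewrite Z.
  assert (P := fun a => Rle_0_sqr (coframe kappa tau (f p) v a)). unfold Rsqr in P.
  generalize (P ix) (P iy) (P iz). intros.
  destruct a; apply Rsqr_0_uniq; unfold Rsqr; lra.
Qed.

Lemma push_inj X Y : (forall k, push f X p k = push f Y p k) -> forall i, X p i = Y p i.
Proof.
  intros H i. apply Rminus_diag_uniq.
  apply (proj2 (proj2 (immersed_near_at _ _ _ Hn)) (fun i => X p i - Y p i)).
  intros k. rewrite <- (Rminus_diag_eq _ _ (H k)). unfold push, sum2. ring.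
Qed.

(** If the Gram determinant vanished, the combination [- g_uv d_u + g_uu d_v] would
    have length 0, hence vanish by injectivity of the differential. *)
Lemma induced_det_neq0 : det2 (g p) <> 0.
Proof.
  intros H.
  assert (Z : forall X, bcv_inner kappa tau (f p) (push f X p) (push f X p) = 0 ->
     forall i, X p i = 0).
  { intros X HX. apply (push_inj X (fun _ _ => 0)). intros k. rewrite (inner_self_0 _ HX).
    unfold push, sum2. ring. }
  assert (G : g p iu iu = 0).
  { apply (Z (fun _ i => match i with iu => - g p iu iv | iv => g p iu iu end)) with (i := iv).
    rewrite inner_push_push. unfold sum2. rewrite (induced_metric_sym iv iu).
    unfold det2 in H. rewrite (induced_metric_sym iv iu) in H.
    transitivity (g p iu iu * (g p iu iu * g p iv iv - g p iu iv * g p iu iv)); [ring|].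
    rewrite H. ring. }
  assert (C := Z (coord iu) G iu). simpl in C. lra.
Qed.

Lemma induced_nondeg (x y : vec2) :
  (forall l, sum2 (fun m => g p l m * x m) = sum2 (fun m => g p l m * y m)) -> forall i, x i = y i.
Proof.
  intros H. assert (D := induced_det_neq0). unfold det2 in D.
  generalize (H iu) (H iv). unfold sum2. clear H. intros H1 H2.
  assert (E : forall d, d * (g p iu iu * g p iv iv - g p iu iv * g p iv iu) = 0 -> d = 0).
  { intros d Hd. apply Rmult_integral in Hd. tauto. }
  intros []; apply Rminus_diag_uniq, E.
  - transitivity (g p iv iv * (g p iu iu * x iu + g p iu iv * x iv - (g p iu iu * y iu + g p iu iv * y iv))
      - g p iu iv * (g p iv iu * x iu + g p iv iv * x iv - (g p iv iu * y iu + g p iv iv * y iv))); [ring|].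
    rewrite H1, H2. ring.
  - transitivity (g p iu iu * (g p iv iu * x iu + g p iv iv * x iv - (g p iv iu * y iu + g p iv iv * y iv))
     - g p iv iu * (g p iu iu * x iu + g p iu iv * x iv - (g p iu iu * y iu + g p iu iv * y iv))); [ring|].
    rewrite H1, H2. ring.
Qed.

Lemma inv2_spec (G : ix2 -> ix2 -> R) (v : vec2) i : det2 G <> 0 -> G iu iv = G iv iu ->
  sum2 (fun m => G i m * sum2 (fun l => inv2 G m l * v l)) = v i.
Proof.
  intros H E. unfold inv2, det2, sum2 in *.
  destruct i; simpl in *; rewrite E in *; field; assumption.
Qed.

Lemma smooth_push_coord i k : smooth_at (fun q => push f (coord i) q k) p.
Proof. apply smooth_push; auto. intros; apply smooth_coord. Qed.

Lemma d2_induced_metric i j l : d2 i (fun q => g q j l) p =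
  bcv_inner kappa tau (f p) (bcv_conn kappa tau f (coord i) (push f (coord j)) p) (push f (coord l) p)
  + bcv_inner kappa tau (f p) (bcv_conn kappa tau f (coord i) (push f (coord l)) p) (push f (coord j) p).
Proof.
  rewrite <- dir_deriv_coord. unfold induced_metric.
  rewrite (conn_inner kappa tau f p Hf HD (coord i) (push f (coord j)) (push f (coord l))).
  - f_equal. apply inner_sym.
  - apply smooth_push_coord.
  - apply smooth_push_coord.
  - now apply immersed_near_bcv.
Qed.

Lemma inner_ext v v' w : (forall k, v k = v' k) -> bcv_inner kappa tau (f p) v w = bcv_inner kappa tau (f p) v' w.
Proof. intros H. unfold bcv_inner, sum3. now rewrite !H. Qed.

(** Koszul's formula: with [Q i j l = <nabla_i f_j, f_l>], metric compatibility gives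
    [d_i g_jl = Q i j l + Q i l j], and the symmetry of [Q] in its first two indices
    collapses the six terms. *)
Lemma metric_lc_christoffel i j l :
  sum2 (fun m => g p l m * christoffel ix2 (R * R) sum2 d2 inv2 g p m i j) =
  bcv_inner kappa tau (f p) (bcv_conn kappa tau f (coord i) (push f (coord j)) p) (push f (coord l) p).
Proof.
  transitivity (/ 2 * sum2 (fun m => g p l m * sum2 (fun n => inv2 (g p) m n *
   (d2 i (fun q => g q j n) p + d2 j (fun q => g q i n) p - d2 n (fun q => g q i j) p)))).
  { unfold christoffel, sum2. ring. }
  rewrite (inv2_spec (g p) (fun m => d2 i (fun q => g q j m) p + d2 j (fun q => g q i m) p - d2 m (fun q => g q i j) p)).
  - rewrite !d2_induced_metric.
    rewrite (inner_ext _ _ _ (conn_coord_sym kappa tau f p Hf HD j i)).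
    rewrite (inner_ext _ _ _ (conn_coord_sym kappa tau f p Hf HD l i)).
    rewrite (inner_ext _ _ _ (conn_coord_sym kappa tau f p Hf HD l j)).
    field.
  - apply induced_det_neq0.
  - apply induced_metric_sym.
Qed.

(** Gauss *)
Lemma gauss_formula X Y l : (forall i, smooth_at (fun q => Y q i) p) ->
  sum2 (fun m => g p l m * lc_conn g X Y p m) =
  bcv_inner kappa tau (f p) (bcv_conn kappa tau f X (push f Y) p) (push f (coord l) p).
Proof.
  intros HY.
  rewrite (inner_ext _ _ _ (fun k => conn_push kappa tau f p Hf X Y k HY)).
  transitivity (sum2 (fun j => dir_deriv X (fun q => Y q j) p * g p j l) +
    sum2 (fun i => sum2 (fun j => X p i * Y p j *
    bcv_inner kappa tau (f p) (bcv_conn kappa tau f (coord i) (push f (coord j)) p) (push f (coord l) p)))).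
  - unfold sum2. rewrite <- !metric_lc_christoffel. unfold lc_conn, sum2.
    rewrite !(induced_metric_sym _ l). ring.
  - unfold induced_metric, bcv_inner, sum2, sum3. ring.
Qed.

(** The form in which the Gauss formula is applied: it suffices to write the
    ambient derivative of [Y] as a tangent vector plus a multiple of a normal [n]. *)
Lemma lc_conn_tangential_part X Y V (n : vec3) (m : R) : (forall i, smooth_at (fun q => Y q i) p) ->
  (forall l, bcv_inner kappa tau (f p) n (push f (coord l) p) = 0) ->
  (forall a, coframe kappa tau (f p) (bcv_conn kappa tau f X (push f Y) p) a =
     coframe kappa tau (f p) (push f V p) a + m * coframe kappa tau (f p) n a) ->
  forall i, lc_conn g X Y p i = V p i.
Proof.
  intros HY Hnrm E. apply induced_nondeg. intros l. rewrite gauss_formula; auto.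
  transitivity (bcv_inner kappa tau (f p) (push f (coord l) p) (push f V p)).
  - rewrite <- (Rplus_0_r (bcv_inner _ _ _ _ (push f V p))).
    rewrite <- (Rmult_0_r m), <- (Hnrm l).
    rewrite !bcv_inner_coframe by assumption. unfold dot, sum3. rewrite !E. ring.
  - rewrite inner_push. unfold sum2, induced_metric. ring.
Qed.

Lemma smooth_inner W1 W2 : (forall k, smooth_at (fun q => W1 q k) p) ->
  (forall k, smooth_at (fun q => W2 q k) p) ->
  smooth_at (fun q => bcv_inner kappa tau (f q) (W1 q) (W2 q)) p.
Proof.
  intros H1 H2. apply smooth_at_ext with
    (fun q => dot (coframe kappa tau (f q) (W1 q)) (coframe kappa tau (f q) (W2 q))).
  - generalize (immersed_near_bcv _ _ _ Hn). apply filter_imp. intros q Hq. symmetry.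
    now apply bcv_inner_coframe.
  - assert (S1 := fun a => smooth_coframe kappa tau f p Hf HD W1 a H1).
    assert (S2 := fun a => smooth_coframe kappa tau f p Hf HD W2 a H2).
    unfold dot, sum3. smooth.
Qed.

Lemma smooth_induced_metric i j : smooth_at (fun q => g q i j) p.
Proof. apply smooth_inner; apply smooth_push_coord. Qed.

End Immersion.

Section Lift.
Variables (kappa tau : R) (f : R * R -> vec3) (p : R * R).
Hypothesis Hn : immersed_near kappa f p.
Let HD : in_bcv kappa (f p) := proj1 (immersed_near_at _ _ _ Hn).
Let Hf : forall k, smooth_at (fun q => f q k) p := proj1 (proj2 (immersed_near_at _ _ _ Hn)).
Notation g := (induced_metric kappa tau f).

(** The tangent field with image [W], when [W] is tangent. *)
Definition lift (W : R * R -> vec3) : R * R -> vec2 := fun q i =>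
  sum2 (fun j => inv2 (g q) i j * bcv_inner kappa tau (f q) (W q) (push f (coord j) q)).

Lemma smooth_inv2 i j : smooth_at (fun q => inv2 (g q) i j) p.
Proof.
  assert (G := smooth_induced_metric kappa tau f p Hn).
  assert (D := induced_det_neq0 kappa tau f p Hn). unfold det2 in D.
  destruct i, j; unfold inv2, det2; smooth.
Qed.

Lemma smooth_lift W i : (forall k, smooth_at (fun q => W q k) p) ->
  smooth_at (fun q => lift W q i) p.
Proof.
  intros HW. assert (I := smooth_inv2).
  assert (S := fun j => smooth_inner kappa tau f p Hn W (push f (coord j)) HW
    (smooth_push_coord kappa f p Hn j)).
  unfold lift, sum2. apply smooth_at_plus; apply smooth_at_mult; auto.
Qed.

Lemma lift_push X i : lift (push f X) p i = X p i.
Proof.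
  revert i. apply (induced_nondeg kappa tau f p Hn). intros l.
  unfold lift. rewrite (inv2_spec (g p) (fun j => bcv_inner kappa tau (f p) (push f X p) (push f (coord j) p))).
  - rewrite inner_sym, inner_push. unfold sum2, induced_metric. ring.
  - now apply (induced_det_neq0 kappa tau f p Hn).
  - apply induced_metric_sym.
Qed.
End Lift.

(** A field that is only known through its image under the differential is smooth,
    since it is recovered from that image with the inverse metric. *)
Lemma smooth_tangent kappa (tau : R) f X W p i : immersed_near kappa f p ->
  (forall k, smooth_at (fun q => W q k) p) ->
  locally p (fun q => forall k, push f X q k = W q k) ->
  smooth_at (fun q => X q i) p.
Proof.
  intros Hn HW E. apply smooth_at_ext with (fun q => lift kappa tau f W q i).
  - generalize (filter_and _ _ E (immersed_near_near _ _ _ Hn)). apply filter_imp.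
    intros q [Eq Hq]. rewrite <- (lift_push kappa tau f q Hq X i).
    unfold lift, sum2. now rewrite !(inner_ext kappa tau f q _ _ _ Eq).
  - now apply smooth_lift.
Qed.

(** * Gaussian curvature in a moving frame *)

Section Curvature.
Variable g : R * R -> ix2 -> ix2 -> R.
Notation Gam i j k := (fun q => christoffel ix2 (R * R) sum2 d2 inv2 g q k i j).

Lemma smooth_christoffel p i j k : (forall i j, smooth_at (fun q => g q i j) p) ->
  det2 (g p) <> 0 -> smooth_at (Gam i j k) p.
Proof.
  intros G D. assert (I : forall i j, smooth_at (fun q => inv2 (g q) i j) p).
  { unfold det2 in D. intros [] []; unfold inv2, det2; smooth. }
  unfold christoffel, sum2. smooth.
Qed.

Lemma lc_coord i X p k :
  lc_conn g (coord i) X p k = d2 i (fun q => X q k) p + sum2 (fun j => Gam i j k p * X p j).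
Proof. unfold lc_conn. rewrite dir_deriv_coord. destruct i; unfold sum2, coord; ring. Qed.

(** The components [R^k_j] of the curvature operator [R(d_u, d_v)]. *)
Definition curv_op p j k : R :=
  d2 iu (Gam iv j k) p - d2 iv (Gam iu j k) p
  + sum2 (fun m => Gam iu m k p * Gam iv j m p - Gam iv m k p * Gam iu j m p).

Lemma gauss_curv_op p : gauss_curv g p =
  sum2 (fun k => g p k iu * curv_op p iv k) / det2 (g p).
Proof.
  unfold gauss_curv. f_equal.
  assert (E : forall i j k q, lc_conn g (coord i) (coord j) q k = Gam i j k q).
  { intros i j k q. rewrite lc_coord.
    rewrite (d2_ext i (fun q => coord j q k) (fun _ => coord j q k))
      by (apply filter_forall; reflexivity).
    rewrite d2_const. destruct j; unfold sum2, coord; ring. }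
  unfold sum2 at 1 2. rewrite !lc_coord. unfold sum2. rewrite !E.
  rewrite !(fun i j k l => d2_ext l (fun q => lc_conn g (coord i) (coord j) q k) (Gam i j k) p
    (filter_forall _ (E i j k))).
  unfold curv_op, sum2. ring.
Qed.

(** Differentiating [nabla_i X = alpha_i Y] once more and antisymmetrizing leaves
    [R(d_u, d_v) X = d alpha (d_u, d_v) Y]: the terms in [alpha_u alpha_v] cancel
    because [nabla_i Y = - alpha_i X]. *)
Lemma curv_op_frame X Y (al : R * R -> vec2) p k :
  (forall i j, smooth_at (fun q => g q i j) p) -> det2 (g p) <> 0 ->
  (forall i, smooth_at (fun q => X q i) p) -> (forall i, smooth_at (fun q => Y q i) p) ->
  (forall i, smooth_at (fun q => al q i) p) ->
  locally p (fun q => forall i k, lc_conn g (coord i) X q k = al q i * Y q k) ->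
  (forall i k, lc_conn g (coord i) Y p k = - al p i * X p k) ->
  sum2 (fun j => curv_op p j k * X p j) =
  (d2 iu (fun q => al q iv) p - d2 iv (fun q => al q iu) p) * Y p k.
Proof.
  intros Hg D HX HY Ha EX EY.
  assert (G := fun i j k => smooth_christoffel p i j k Hg D).
  assert (A : forall l i, d2 l (d2 i (fun q => X q k)) p =
    d2 l (fun q => al q i) p * Y p k + al p i * d2 l (fun q => Y q k) p
    - sum2 (fun j => d2 l (Gam i j k) p * X p j + Gam i j k p * d2 l (fun q => X q j) p)).
  { intros l i.
    rewrite (d2_ext l (d2 i (fun q => X q k)) (fun q => al q i * Y q k
      - (Gam i iu k q * X q iu + Gam i iv k q * X q iv))).
    - rewrite d2_minus, d2_plus, !d2_mult; smooth.
    - revert EX. apply filter_imp. intros q E. rewrite <- E, lc_coord. unfold sum2. ring. }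
  assert (C := d2_comm iu iv (fun q => X q k) p (HX k)).
  rewrite !A in C.
  assert (BX : forall i k, d2 i (fun q => X q k) p = al p i * Y p k - sum2 (fun j => Gam i j k p * X p j)).
  { intros i m. rewrite <- (locally_singleton _ _ EX i m), lc_coord. ring. }
  assert (BY : forall i k, d2 i (fun q => Y q k) p = - al p i * X p k - sum2 (fun j => Gam i j k p * Y p j)).
  { intros i m. rewrite <- (EY i m), lc_coord. ring. }
  unfold sum2 in C. rewrite !BX, !BY in C. unfold sum2 in C.
  unfold curv_op, sum2. apply Rminus_diag_uniq.
  apply Rminus_diag_eq in C.
  match type of C with ?c = 0 => transitivity (- c) end; [ring | rewrite C; ring].
Qed.

(** By [curv_op_frame], [R(d_u, d_v)] acts on the orthogonal frame [X, Y] as a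
    rotation by [d alpha]; what remains is the change of basis from [X, Y] to
    [d_u, d_v], of determinant [de]. *)
Lemma gauss_curv_frame X Y (al : R * R -> vec2) r p :
  (forall i j, smooth_at (fun q => g q i j) p) -> det2 (g p) <> 0 -> g p iu iv = g p iv iu ->
  (forall i, smooth_at (fun q => X q i) p) -> (forall i, smooth_at (fun q => Y q i) p) ->
  (forall i, smooth_at (fun q => al q i) p) ->
  locally p (fun q => forall i k, lc_conn g (coord i) X q k = al q i * Y q k) ->
  locally p (fun q => forall i k, lc_conn g (coord i) Y q k = - al q i * X q k) ->
  r <> 0 ->
  sum2 (fun i => sum2 (fun j => X p i * X p j * g p i j)) = r ->
  sum2 (fun i => sum2 (fun j => Y p i * Y p j * g p i j)) = r ->
  sum2 (fun i => sum2 (fun j => X p i * Y p j * g p i j)) = 0 ->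
  gauss_curv g p * r =
  - ((d2 iu (fun q => al q iv) p - d2 iv (fun q => al q iu) p)
     * (X p iu * Y p iv - X p iv * Y p iu)).
Proof.
  intros Hg D S HX HY Ha EX EY Hr XX YY XY.
  assert (RX := fun k => curv_op_frame X Y al p k Hg D HX HY Ha EX (locally_singleton _ _ EY)).
  assert (RY : forall k, sum2 (fun j => curv_op p j k * Y p j) =
     - (d2 iu (fun q => al q iv) p - d2 iv (fun q => al q iu) p) * X p k).
  { intros k. rewrite (curv_op_frame Y X (fun q i => - al q i) p k); smooth.
    - rewrite !d2_opp. ring.
    - intros i; smooth.
    - intros i m. rewrite (locally_singleton _ _ EX). ring. }
  rewrite gauss_curv_op.
  generalize dependent (curv_op p). intros Rm RX RY.
  generalize dependent (d2 iu (fun q => al q iv) p - d2 iv (fun q => al q iu) p).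
  intros A RX RY.
  assert (RXu := RX iu). assert (RXv := RX iv). assert (RYu := RY iu). assert (RYv := RY iv).
  clear RX RY EX EY Hg HX HY Ha.
  unfold sum2, det2 in *. rewrite S in *. clear S.
  revert Hr D RXu RXv RYu RYv XX YY XY.
  generalize (Rm iu iu) (Rm iu iv) (Rm iv iu) (Rm iv iv) (X p iu) (X p iv) (Y p iu) (Y p iv)
   (g p iu iu) (g p iv iu) (g p iv iv).
  clear. intros r1 r2 r3 r4 xu xv yu yv E F G Hr D RXu RXv RYu RYv XX YY XY.
  set (de := xu * yv - xv * yu).
  assert (Hde : de ^ 2 * (E * G - F * F) = r ^ 2).
  { transitivity ((xu * xu * E + xu * xv * F + (xv * xu * F + xv * xv * G)) *
      (yu * yu * E + yu * yv * F + (yv * yu * F + yv * yv * G)) -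
      (xu * yu * E + xu * yv * F + (xv * yu * F + xv * yv * G)) ^ 2); [unfold de; ring|].
    rewrite XX, YY, XY. ring. }
  assert (R3 : r3 * de = - A * (xu * xu + yu * yu)).
  { transitivity (xu * (r1 * yu + r3 * yv) - yu * (r1 * xu + r3 * xv)); [unfold de; ring|].
    rewrite RXu, RYu. ring. }
  assert (R4 : r4 * de = - A * (xu * xv + yu * yv)).
  { transitivity (xu * (r2 * yu + r4 * yv) - yu * (r2 * xu + r4 * xv)); [unfold de; ring|].
    rewrite RXv, RYv. ring. }
  assert (N0 : de <> 0).
  { intros Z. rewrite Z in Hde. apply Hr. apply Rsqr_0_uniq. unfold Rsqr. simpl in Hde. lra. }
  assert (GX : (xu * E + xv * F) * de = r * yv).
  { transitivity (yv * (xu * xu * E + xu * xv * F + (xv * xu * F + xv * xv * G))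
     - xv * (xu * yu * E + xu * yv * F + (xv * yu * F + xv * yv * G))); [unfold de; ring|].
    rewrite XX, XY. ring. }
  assert (GY : (yu * E + yv * F) * de = - r * xv).
  { transitivity (yv * (xu * yu * E + xu * yv * F + (xv * yu * F + xv * yv * G))
     - xv * (yu * yu * E + yu * yv * F + (yv * yu * F + yv * yv * G))); [unfold de; ring|].
    rewrite YY, XY. ring. }
  assert (K : (E * r3 + F * r4) * de ^ 2 = - A * r * de).
  { transitivity ((E * (r3 * de) + F * (r4 * de)) * de); [ring|]. rewrite R3, R4.
    transitivity (- A * (xu * ((xu * E + xv * F) * de) + yu * ((yu * E + yv * F) * de))); [ring|].
    rewrite GX, GY. unfold de. ring. }
  apply (Rmult_eq_reg_r (de ^ 2 * (E * G - F * F))).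
  2:{ rewrite Hde. now apply pow_nonzero. }
  transitivity ((E * r3 + F * r4) * de ^ 2 * r); [field; assumption|].
  rewrite K, Hde. ring.
Qed.

Lemma lc_dir V X p k : lc_conn g V X p k = sum2 (fun i => V p i * lc_conn g (coord i) X p k).
Proof. unfold sum2. rewrite !lc_coord. unfold lc_conn, dir_deriv, sum2. ring. Qed.

(** The right-hand side consists of the components of the bracket [[X, Y]]. *)
Lemma lc_bracket X Y p k : locally p (fun q => forall i j, g q i j = g q j i) ->
  lc_conn g X Y p k - lc_conn g Y X p k =
  dir_deriv X (fun q => Y q k) p - dir_deriv Y (fun q => X q k) p.
Proof.
  intros S.
  assert (E : Gam iv iu k p = Gam iu iv k p).
  { assert (F : forall l, d2 l (fun q => g q iv iu) p = d2 l (fun q => g q iu iv) p).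
    { intros l. apply d2_ext. revert S. apply filter_imp. auto. }
    unfold christoffel. f_equal. unfold sum2. rewrite !F. ring. }
  assert (L : forall X Y, lc_conn g X Y p k = dir_deriv X (fun q => Y q k) p
    + (Gam iu iu k p * X p iu * Y p iu + Gam iu iv k p * X p iu * Y p iv
    + (Gam iv iu k p * X p iv * Y p iu + Gam iv iv k p * X p iv * Y p iv))) by reflexivity.
  rewrite !L, E. ring.
Qed.

Definition pair_form (al : R * R -> vec2) (X : R * R -> vec2) : R * R -> R :=
  fun q => sum2 (fun i => X q i * al q i).

Lemma exterior_derivative (al X Y : R * R -> vec2) p :
  (forall i, smooth_at (fun q => X q i) p) -> (forall i, smooth_at (fun q => Y q i) p) ->
  (forall i, smooth_at (fun q => al q i) p) ->
  (d2 iu (fun q => al q iv) p - d2 iv (fun q => al q iu) p) * (X p iu * Y p iv - X p iv * Y p iu) =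
  dir_deriv X (pair_form al Y) p - dir_deriv Y (pair_form al X) p
  - sum2 (fun i => (dir_deriv X (fun q => Y q i) p - dir_deriv Y (fun q => X q i) p) * al p i).
Proof.
  intros HX HY Ha. unfold pair_form, sum2. rewrite !dir_deriv_plus, !dir_deriv_mult; smooth.
  unfold dir_deriv, sum2. ring.
Qed.

(** Here [d alpha (X, Y) = X[alpha(Y)] - Y[alpha(X)] - alpha([X, Y])], and the
    bracket is [nabla_X Y - nabla_Y X = - alpha(X) X - alpha(Y) Y]. *)
Lemma gauss_curv_structure X Y (al : R * R -> vec2) r p :
  (forall i j, smooth_at (fun q => g q i j) p) -> det2 (g p) <> 0 ->
  locally p (fun q => forall i j, g q i j = g q j i) ->
  (forall i, smooth_at (fun q => X q i) p) -> (forall i, smooth_at (fun q => Y q i) p) ->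
  (forall i, smooth_at (fun q => al q i) p) ->
  locally p (fun q => forall i k, lc_conn g (coord i) X q k = al q i * Y q k) ->
  locally p (fun q => forall i k, lc_conn g (coord i) Y q k = - al q i * X q k) ->
  r <> 0 ->
  sum2 (fun i => sum2 (fun j => X p i * X p j * g p i j)) = r ->
  sum2 (fun i => sum2 (fun j => Y p i * Y p j * g p i j)) = r ->
  sum2 (fun i => sum2 (fun j => X p i * Y p j * g p i j)) = 0 ->
  gauss_curv g p * r =
  - (dir_deriv X (pair_form al Y) p - dir_deriv Y (pair_form al X) p + pair_form al X p ^ 2 + pair_form al Y p ^ 2).
Proof.
  intros Hg D S HX HY Ha EX EY Hr XX YY XY.
  rewrite (gauss_curv_frame X Y al r p) by (auto; now apply (locally_singleton _ _ S)).
  rewrite exterior_derivative by assumption.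
  apply locally_singleton in EX. apply locally_singleton in EY.
  unfold sum2 at 1. rewrite <- !(lc_bracket _ _ _ _ S).
  rewrite !(lc_dir X Y), !(lc_dir Y X). unfold pair_form, sum2. rewrite !EX, !EY. ring.
Qed.
End Curvature.

(** * Constant angle surfaces in a chart *)

(** The hypotheses of the theorem at one point of the parameter domain, [c] being
    the cosine of the angle. *)
Definition angle_at (kappa tau c : R) (f W : R * R -> vec3) (T J : R * R -> vec2) (q : R * R) : Prop :=
  immersed_at kappa f q /\ (forall k, smooth_at (fun r => W r k) q) /\
  bcv_inner kappa tau (f q) (W q) (W q) = 1 /\
  (forall i, bcv_inner kappa tau (f q) (W q) (push f (coord i) q) = 0) /\
  bcv_inner kappa tau (f q) (bcv_frame kappa tau (f q) iz) (W q) = c /\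
  (forall k, push f T q k + c * W q k = bcv_frame kappa tau (f q) iz k) /\
  (forall k, push f J q k = bcv_cross kappa tau (f q) (W q) (push f T q) k).

Lemma coframe_cross kappa tau x v w a : in_bcv kappa x ->
  coframe kappa tau x (bcv_cross kappa tau x v w) a =
  coframe kappa tau x v (nxt a) * coframe kappa tau x w (nxt (nxt a))
  - coframe kappa tau x v (nxt (nxt a)) * coframe kappa tau x w (nxt a).
Proof.
  intros H.
  assert (E : forall u b, bcv_inner kappa tau x u (bcv_frame kappa tau x b) = coframe kappa tau x u b).
  { intros u b. rewrite bcv_inner_coframe by assumption. unfold dot, sum3.
    rewrite !coframe_frame by assumption. destruct b; ring. }
  unfold bcv_cross, sum3. rewrite !E.
  assert (L : forall r1 r2 r3 b, coframe kappa tau x (fun k => r1 * bcv_frame kappa tau x ix k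
     + r2 * bcv_frame kappa tau x iy k + r3 * bcv_frame kappa tau x iz k) b =
     r1 * coframe kappa tau x (bcv_frame kappa tau x ix) b
     + r2 * coframe kappa tau x (bcv_frame kappa tau x iy) b
     + r3 * coframe kappa tau x (bcv_frame kappa tau x iz) b).
  { intros. destruct b; unfold coframe, sum3, Rdiv; ring. }
  rewrite L, !coframe_frame by assumption. destruct a; simpl; ring.
Qed.

Lemma coframe_push {kappa tau f p} X a :
  coframe kappa tau (f p) (push f X p) a =
  sum2 (fun i => X p i * coframe kappa tau (f p) (push f (coord i) p) a).
Proof.
  destruct a; unfold coframe, sum3, Rdiv; rewrite !(push_sum f X); unfold sum2; ring.
Qed.

(** The connection form of the base, pulled back to the surface. *)
Definition base_form (kappa tau : R) f q : vec2 := fun i =>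
  kappa / 2 * (f q ix * coframe kappa tau (f q) (push f (coord i) q) iy
             - f q iy * coframe kappa tau (f q) (push f (coord i) q) ix).

Lemma pair_base_form {kappa tau f p} X : pair_form (base_form kappa tau f) X p =
  kappa / 2 * (f p ix * coframe kappa tau (f p) (push f X p) iy
             - f p iy * coframe kappa tau (f p) (push f X p) ix).
Proof. unfold pair_form, base_form, sum2. rewrite !(coframe_push X). unfold sum2. ring. Qed.

(** The differential of the angle [phi] in
    [(n_1, n_2) = sqrt (1 - c^2) (cos phi, sin phi)], written without [phi]. *)
Definition azimuth_form (kappa tau c : R) f W q : vec2 := fun i =>
  let n r := coframe kappa tau (f r) (W r) in
  (n q ix * d2 i (fun r => n r iy) q - n q iy * d2 i (fun r => n r ix) q) / (1 - c * c).

(** The rotation of the horizontal part of [N] that is left after removing the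
    rotation of the frame [e_1, e_2] itself. *)
Definition normal_spin (kappa tau c : R) f W q X : R :=
  pair_form (azimuth_form kappa tau c f W) X q - pair_form (base_form kappa tau f) X q
  - tau * coframe kappa tau (f q) (push f X q) iz.

(** The connection form of the tangent frame [T, JT]. *)
Definition frame_form (kappa tau c : R) f W q : vec2 := fun i =>
  c * (azimuth_form kappa tau c f W q i - base_form kappa tau f q i
       - 2 * tau * coframe kappa tau (f q) (push f (coord i) q) iz).

(** The coefficient [lambda].  When [c = 1] both factors of the numerator vanish
    and so does the quotient. *)
Definition shape_coef (kappa tau c : R) f W (J : R * R -> vec2) q : R :=
  bcv_inner kappa tau (f q) (shape kappa tau f W J q) (push f J q) / (1 - c * c).

(* The sections below assume the hypotheses near a single point [p].  They are
   closed one after the other so that the pointwise results become available at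
   all points near [p] and can be differentiated. *)

Section Point.
Context {kappa tau c : R} {f W : R * R -> vec3} {T J : R * R -> vec2} {p : R * R}.
Hypothesis HL : locally p (angle_at kappa tau c f W T J).
Notation n q := (coframe kappa tau (f q) (W q)).
Notation xi X := (coframe kappa tau (f p) (push f X p)).
Notation g := (induced_metric kappa tau f).

Lemma angle_immersed : immersed_near kappa f p.
Proof. unfold immersed_near. generalize HL. apply filter_imp. now intros q (H & _). Qed.
Let Hn : immersed_near kappa f p := angle_immersed.
Let HD : in_bcv kappa (f p) := proj1 (immersed_near_at _ _ _ Hn).
Let Hf : forall k, smooth_at (fun q => f q k) p := proj1 (proj2 (immersed_near_at _ _ _ Hn)).
Let HA : angle_at kappa tau c f W T J p := locally_singleton _ _ HL.
Let HW : forall k, smooth_at (fun r => W r k) p := proj1 (proj2 HA).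

Lemma smooth_normal a : smooth_at (fun q => n q a) p.
Proof. now apply smooth_coframe. Qed.

Lemma normal_z : n p iz = c.
Proof.
  generalize HA; intros (_ & _ & _ & _ & E & _).
  rewrite bcv_inner_coframe in E by assumption. unfold dot, sum3 in E.
  rewrite !coframe_frame in E by assumption. lra.
Qed.

Lemma normal_xy : n p ix * n p ix + n p iy * n p iy = 1 - c * c.
Proof.
  generalize HA; intros (_ & _ & E & _). rewrite bcv_inner_coframe in E by assumption.
  unfold dot, sum3 in E. rewrite normal_z in E. lra.
Qed.

Lemma normal_tangent X : n p ix * xi X ix + n p iy * xi X iy + c * xi X iz = 0.
Proof.
  generalize HA; intros (_ & _ & _ & E & _).
  rewrite <- normal_z. change (dot (n p) (xi X) = 0).
  rewrite <- bcv_inner_coframe by assumption. rewrite (inner_push kappa tau f p (W p) X). unfold sum2.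
  rewrite !E. ring.
Qed.

Lemma coframe_T a : xi T a = match a with iz => 1 - c * c | _ => - c * n p a end.
Proof.
  generalize HA; intros (_ & _ & _ & _ & _ & E & _).
  assert (F := coframe_plus kappa tau f p (push f T p) (fun k => c * W p k) a).
  rewrite coframe_scal in F.
  assert (G : coframe kappa tau (f p) (fun k => push f T p k + c * W p k) a
     = coframe kappa tau (f p) (bcv_frame kappa tau (f p) iz) a).
  { destruct a; unfold coframe, sum3; now rewrite !E. }
  rewrite G, coframe_frame in F by assumption.
  generalize normal_z. destruct a; intros Z; try rewrite Z in F; lra.
Qed.

Lemma coframe_JT a : xi J a = match a with ix => n p iy | iy => - n p ix | iz => 0 end.
Proof.
  generalize HA; intros (_ & _ & _ & _ & _ & _ & E).
  transitivity (coframe kappa tau (f p) (bcv_cross kappa tau (f p) (W p) (push f T p)) a).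
  { destruct a; unfold coframe, sum3; now rewrite !E. }
  rewrite coframe_cross by assumption.
  destruct a; cbn [nxt]; rewrite ?coframe_T, ?normal_z; cbv iota; ring.
Qed.
End Point.

Section Neighbourhood.
Context {kappa tau c : R} {f W : R * R -> vec3} {T J : R * R -> vec2} {p : R * R}.
Hypothesis HL : locally p (angle_at kappa tau c f W T J).
Notation n q := (coframe kappa tau (f q) (W q)).
Notation xi X := (coframe kappa tau (f p) (push f X p)).
Notation g := (induced_metric kappa tau f).
Let Hn : immersed_near kappa f p := angle_immersed HL.
Let HD : in_bcv kappa (f p) := proj1 (immersed_near_at _ _ _ Hn).
Let Hf : forall k, smooth_at (fun q => f q k) p := proj1 (proj2 (immersed_near_at _ _ _ Hn)).
Let HA : angle_at kappa tau c f W T J p := locally_singleton _ _ HL.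
Let HW : forall k, smooth_at (fun r => W r k) p := proj1 (proj2 HA).
Let HLL : locally p (fun q => locally q (angle_at kappa tau c f W T J)) := locally_locally _ _ HL.

Lemma normal_z_deriv X : dir_deriv X (fun q => n q iz) p = 0.
Proof.
  rewrite (dir_deriv_ext X _ (fun _ => c)), ?dir_deriv_const; auto.
  generalize HLL. apply filter_imp. intros q Hq. exact (normal_z Hq).
Qed.

Lemma normal_xy_deriv X :
  n p ix * dir_deriv X (fun q => n q ix) p + n p iy * dir_deriv X (fun q => n q iy) p = 0.
Proof.
  assert (S := smooth_normal HL).
  assert (E : dir_deriv X (fun q => n q ix * n q ix + n q iy * n q iy) p = 0).
  { rewrite (dir_deriv_ext X _ (fun _ => 1 - c * c)), ?dir_deriv_const; auto.
    generalize HLL. apply filter_imp. intros q Hq. exact (normal_xy Hq). }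
  rewrite dir_deriv_plus, !dir_deriv_mult in E; smooth. lra.
Qed.

(** Differentiating [<N, f_j> = 0] gives [<nabla_i N, f_j> = - <N, nabla_i f_j>],
    which is symmetric in [i] and [j]. *)
Lemma second_form_sym X Y :
  dot (coframe kappa tau (f p) (bcv_conn kappa tau f X W p)) (xi Y) =
  dot (coframe kappa tau (f p) (bcv_conn kappa tau f Y W p)) (xi X).
Proof.
  assert (E : forall i j, bcv_inner kappa tau (f p) (bcv_conn kappa tau f (coord i) W p) (push f (coord j) p)
    = - bcv_inner kappa tau (f p) (W p) (bcv_conn kappa tau f (coord i) (push f (coord j)) p)).
  { intros i j.
    assert (E := conn_inner kappa tau f p Hf HD (coord i) W (push f (coord j)) HW
       (smooth_push_coord kappa f p Hn j) (immersed_near_bcv _ _ _ Hn)).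
    rewrite (dir_deriv_ext _ _ (fun _ => 0)), dir_deriv_const in E; [lra|].
    generalize HL. apply filter_imp. now intros q (_ & _ & _ & H & _). }
  rewrite <- !bcv_inner_coframe by assumption.
  rewrite (inner_push kappa tau f p _ Y), (inner_push kappa tau f p _ X).
  assert (F : forall X j, bcv_inner kappa tau (f p) (bcv_conn kappa tau f X W p) (push f (coord j) p)
    = - sum2 (fun i => X p i * bcv_inner kappa tau (f p) (W p) (bcv_conn kappa tau f (coord i) (push f (coord j)) p))).
  { intros X' j. rewrite (inner_ext kappa tau f p _ _ _ (conn_dir kappa tau f p X' W)).
    transitivity (sum2 (fun i => X' p i * bcv_inner kappa tau (f p) (bcv_conn kappa tau f (coord i) W p) (push f (coord j) p))).
    - unfold bcv_inner, sum2, sum3. ring.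
    - unfold sum2. rewrite !E. ring. }
  unfold sum2. rewrite !F. unfold sum2.
  rewrite (inner_sym _ _ _ (W p) (bcv_conn kappa tau f (coord iv) (push f (coord iu)) p)).
  rewrite (inner_ext kappa tau f p _ _ _ (conn_coord_sym kappa tau f p Hf HD iv iu)).
  rewrite (inner_sym _ _ _ _ (W p)). ring.
Qed.

Lemma smooth_T i : smooth_at (fun q => T q i) p.
Proof.
  apply (smooth_tangent kappa tau f T (fun q k => bcv_frame kappa tau (f q) iz k - c * W q k)); auto.
  - intros k. apply smooth_at_minus; smooth. destruct k; unfold bcv_frame; exact (smooth_at_const _ p).
  - generalize HL. apply filter_imp. intros q (_ & _ & _ & _ & _ & E & _) k. rewrite <- E. ring.
Qed.

Lemma smooth_JT i : smooth_at (fun q => J q i) p.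
Proof.
  assert (S := smooth_normal HL).
  apply (smooth_tangent kappa tau f J (fun q k =>
     n q iy * bcv_frame kappa tau (f q) ix k - n q ix * bcv_frame kappa tau (f q) iy k)); auto.
  - assert (SD := smooth_bcv_D kappa f p Hf).
    intros k. apply smooth_at_minus; apply smooth_at_mult; auto; destruct k; unfold bcv_frame; smooth.
  - generalize HLL. apply filter_imp. intros q Hq.
    assert (Dq : in_bcv kappa (f q)) by now destruct (locally_singleton _ _ Hq) as [[H _] _].
    apply (coframe_inj kappa tau (f q)); auto. intros a.
    rewrite (coframe_JT Hq a).
    transitivity (n q iy * coframe kappa tau (f q) (bcv_frame kappa tau (f q) ix) a
      - n q ix * coframe kappa tau (f q) (bcv_frame kappa tau (f q) iy) a).
    + rewrite !coframe_frame by assumption. destruct a; ring.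
    + generalize (n q ix) (n q iy). intros r1 r2. destruct a; unfold coframe, sum3, Rdiv; ring.
Qed.

End Neighbourhood.

(** * The oblique case: structure equations *)

Section Oblique.
Context {kappa tau c : R} {f W : R * R -> vec3} {T J : R * R -> vec2} {p : R * R}.
Hypothesis HL : locally p (angle_at kappa tau c f W T J).
Hypothesis Hc : 1 - c * c <> 0.
Notation n q := (coframe kappa tau (f q) (W q)).
Notation xi X := (coframe kappa tau (f p) (push f X p)).
Notation g := (induced_metric kappa tau f).
Notation mu := (azimuth_form kappa tau c f W).
Notation om := (base_form kappa tau f).
Notation nu q X := (normal_spin kappa tau c f W q X).
Notation al := (frame_form kappa tau c f W).
Notation lam := (shape_coef kappa tau c f W J).
Let Hn : immersed_near kappa f p := angle_immersed HL.
Let HD : in_bcv kappa (f p) := proj1 (immersed_near_at _ _ _ Hn).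
Let Hf : forall k, smooth_at (fun q => f q k) p := proj1 (proj2 (immersed_near_at _ _ _ Hn)).
Let HA : angle_at kappa tau c f W T J p := locally_singleton _ _ HL.
Let HW : forall k, smooth_at (fun r => W r k) p := proj1 (proj2 HA).
Let HLL : locally p (fun q => locally q (angle_at kappa tau c f W T J)) := locally_locally _ _ HL.

Lemma pair_azimuth_form X : pair_form mu X p =
  (n p ix * dir_deriv X (fun q => n q iy) p - n p iy * dir_deriv X (fun q => n q ix) p) / (1 - c * c).
Proof. unfold pair_form, azimuth_form, dir_deriv, sum2. field. assumption. Qed.

(** The derivative of [(n_1, n_2)] is orthogonal to it, hence a multiple of
    [(- n_2, n_1)]. *)
Lemma deriv_normal_x X : dir_deriv X (fun q => n q ix) p = - n p iy * pair_form mu X p.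
Proof.
  rewrite pair_azimuth_form. generalize (normal_xy_deriv HL X) (normal_xy HL).
  intros E Q. apply (Rmult_eq_reg_r (1 - c * c)); auto.
  transitivity (dir_deriv X (fun q => n q ix) p * (n p ix * n p ix + n p iy * n p iy)
     - n p ix * (n p ix * dir_deriv X (fun q => n q ix) p + n p iy * dir_deriv X (fun q => n q iy) p)).
  - rewrite E, Q. ring.
  - field. assumption.
Qed.

Lemma deriv_normal_y X : dir_deriv X (fun q => n q iy) p = n p ix * pair_form mu X p.
Proof.
  rewrite pair_azimuth_form. generalize (normal_xy_deriv HL X) (normal_xy HL).
  intros E Q. apply (Rmult_eq_reg_r (1 - c * c)); auto.
  transitivity (dir_deriv X (fun q => n q iy) p * (n p ix * n p ix + n p iy * n p iy)
     - n p iy * (n p ix * dir_deriv X (fun q => n q ix) p + n p iy * dir_deriv X (fun q => n q iy) p)).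
  - rewrite E, Q. ring.
  - field. assumption.
Qed.

Lemma coframe_shape X a : coframe kappa tau (f p) (shape kappa tau f W X p) a =
  match a with
  | ix => n p iy * nu p X - tau * c * xi X iy
  | iy => - n p ix * nu p X + tau * c * xi X ix
  | iz => tau * (xi X iy * n p ix - xi X ix * n p iy)
  end.
Proof.
  transitivity (- coframe kappa tau (f p) (bcv_conn kappa tau f X W p) a).
  { destruct a; unfold shape, coframe, sum3, Rdiv; ring. }
  rewrite coframe_conn by assumption. unfold normal_spin. rewrite pair_base_form.
  destruct a; rewrite ?deriv_normal_x, ?deriv_normal_y, ?(normal_z_deriv HL); unfold frame_rot;
   rewrite ?(normal_z HL); ring.
Qed.

(** This is [<S T, JT> = <S JT, T>], divided by [1 - c^2]. *)
Lemma normal_spin_T : nu p T = - tau * (1 + c * c).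
Proof.
  assert (E : dot (coframe kappa tau (f p) (shape kappa tau f W T p)) (xi J) =
     dot (coframe kappa tau (f p) (shape kappa tau f W J p)) (xi T)).
  { assert (L : forall X Y, dot (coframe kappa tau (f p) (shape kappa tau f W X p)) (xi Y) =
     - dot (coframe kappa tau (f p) (bcv_conn kappa tau f X W p)) (xi Y)).
    { intros X Y. unfold shape, dot, coframe, sum3, Rdiv; ring. }
    rewrite !L. f_equal. apply (second_form_sym HL). }
  unfold dot, sum3 in E. rewrite !coframe_shape in E.
  rewrite !(coframe_T HL), !(coframe_JT HL) in E.
  generalize (normal_xy HL). intros Q.
  apply (Rmult_eq_reg_r (1 - c * c)); auto. rewrite <- Q.
  match type of E with ?l = ?r =>
    transitivity (l - tau * c * c * (n p ix * n p ix + n p iy * n p iy)) end; [ring|].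
  rewrite E.
  transitivity (- tau * (n p ix * n p ix + n p iy * n p iy) * (1 - c * c)
    - 2 * tau * c * c * (n p ix * n p ix + n p iy * n p iy)
     + 0 * nu p J); [| rewrite Q; ring].
  ring.
Qed.

Lemma pair_frame_form X : pair_form al X p = c * (nu p X - tau * xi X iz).
Proof.
  unfold normal_spin. rewrite (coframe_push X iz). unfold pair_form, frame_form, sum2. ring.
Qed.

(** The normal component of [nabla_X T] is [<S X, T>], the third component of
    [S X]. *)
Lemma lc_T X k : lc_conn g X T p k = pair_form al X p * J p k.
Proof.
  apply (lc_conn_tangential_part kappa tau f p Hn X T (fun q i => pair_form al X p * J q i) (W p)
    (tau * (xi X iy * n p ix - xi X ix * n p iy))).
  - apply (smooth_T HL).
  - apply HA.
  - intros a. rewrite coframe_conn by (auto; intros; apply smooth_push; auto; apply (smooth_T HL)).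
    assert (S := smooth_normal HL).
    assert (E : forall a, dir_deriv X (fun q => coframe kappa tau (f q) (push f T q) a) p =
      match a with iz => 0 | _ => - c * dir_deriv X (fun q => n q a) p end).
    { intros b. rewrite (dir_deriv_ext X _ (fun q => match b with iz => 1 - c * c | _ => - c * n q b end)).
      2:{ generalize HLL. apply filter_imp. intros q Hq. apply (coframe_T Hq). }
      destruct b; try apply dir_deriv_const;
      (rewrite dir_deriv_mult, dir_deriv_const; smooth; ring). }
    rewrite E. clear E.
    transitivity (pair_form al X p * xi J a + tau * (xi X iy * n p ix - xi X ix * n p iy) * n p a).
    2:{ f_equal. rewrite !(coframe_push J), (coframe_push (fun q i => pair_form al X p * J q i)). unfold sum2. ring. }
    rewrite pair_frame_form, (coframe_JT HL). unfold normal_spin.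
    destruct a; rewrite ?deriv_normal_x, ?deriv_normal_y, pair_base_form;
    unfold frame_rot; rewrite !(coframe_T HL);
    generalize (normal_xy HL) (normal_z HL) (normal_tangent HL X);
    generalize (n p ix) (n p iy) (n p iz) (xi X ix) (xi X iy) (xi X iz) (pair_form mu X p) (f p ix) (f p iy);
    intros n1 n2 n3 x1 x2 x3 m x y Q -> N;
    apply Rminus_diag_uniq.
    + transitivity (tau * (x2 * (1 - c * c - (n1 * n1 + n2 * n2)) + n2 * (n1 * x1 + n2 * x2 + c * x3))); [ring|].
      rewrite N, Q. ring.
    + transitivity (- tau * (x1 * (1 - c * c - (n1 * n1 + n2 * n2)) + n1 * (n1 * x1 + n2 * x2 + c * x3))); [ring|].
      rewrite N, Q. ring.
    + ring.
Qed.

(** The normal component is [<S X, JT>], by [coframe_shape] and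
    [normal_tangent]. *)
Lemma lc_JT X k : lc_conn g X J p k = - pair_form al X p * T p k.
Proof.
  apply (lc_conn_tangential_part kappa tau f p Hn X J (fun q i => - pair_form al X p * T q i) (W p)
    (nu p X * (1 - c * c) + tau * c * c * xi X iz)).
  - apply (smooth_JT HL).
  - apply HA.
  - intros a. rewrite coframe_conn by (auto; intros; apply smooth_push; auto; apply (smooth_JT HL)).
    assert (S := smooth_normal HL).
    assert (E : forall a, dir_deriv X (fun q => coframe kappa tau (f q) (push f J q) a) p =
      match a with ix => dir_deriv X (fun q => n q iy) p | iy => - dir_deriv X (fun q => n q ix) p | iz => 0 end).
    { intros b. rewrite (dir_deriv_ext X _ (fun q => match b with ix => n q iy | iy => - n q ix | iz => 0 end)).
      2:{ generalize HLL. apply filter_imp. intros q Hq. apply (coframe_JT Hq). }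
      destruct b; [reflexivity | apply dir_deriv_opp | apply dir_deriv_const]. }
    rewrite E. clear E.
    transitivity (- pair_form al X p * xi T a + (nu p X * (1 - c * c) + tau * c * c * xi X iz) * n p a).
    2:{ f_equal. rewrite !(coframe_push T), (coframe_push (fun q i => - pair_form al X p * T q i)). unfold sum2. ring. }
    rewrite pair_frame_form, (coframe_T HL). unfold normal_spin.
    destruct a; rewrite ?deriv_normal_x, ?deriv_normal_y, pair_base_form;
    unfold frame_rot; rewrite !(coframe_JT HL);
    generalize (normal_xy HL) (normal_z HL) (normal_tangent HL X);
    generalize (n p ix) (n p iy) (n p iz) (xi X ix) (xi X iy) (xi X iz) (pair_form mu X p) (f p ix) (f p iy);
    intros n1 n2 n3 x1 x2 x3 m x y Q -> N;
    apply Rminus_diag_uniq.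
    + ring.
    + ring.
    + transitivity (- tau * (n1 * x1 + n2 * x2 + c * x3)); [ring|].
      rewrite N. ring.
Qed.

Lemma shape_coef_spin : lam p = nu p J.
Proof.
  unfold shape_coef. rewrite bcv_inner_coframe by assumption. unfold dot, sum3.
  rewrite !(coframe_shape), !(coframe_JT HL).
  transitivity ((n p ix * n p ix + n p iy * n p iy) * nu p J / (1 - c * c)); [field; auto|].
  rewrite (normal_xy HL). now field.
Qed.

Lemma azimuth_form_JT : pair_form mu J p = lam p - kappa / 2 * (f p ix * n p ix + f p iy * n p iy).
Proof.
  rewrite shape_coef_spin. unfold normal_spin. rewrite pair_base_form, !(coframe_JT HL). ring.
Qed.

Lemma azimuth_form_T : pair_form mu T p = - 2 * tau * c * c + kappa * c / 2 * (f p iy * n p ix - f p ix * n p iy).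
Proof.
  generalize (normal_spin_T). unfold normal_spin.
  rewrite pair_base_form, !(coframe_T HL). intros E.
  apply Rplus_eq_reg_r with (- (kappa / 2 * (f p ix * (- c * n p iy) - f p iy * (- c * n p ix))) - tau * (1 - c * c)).
  transitivity (- tau * (1 + c * c)); [rewrite <- E; ring | field].
Qed.

Lemma frame_form_T : pair_form al T p = - 2 * tau * c.
Proof.
  rewrite pair_frame_form, (normal_spin_T), (coframe_T HL). ring.
Qed.

Lemma frame_form_JT : pair_form al J p = c * lam p.
Proof. rewrite pair_frame_form, shape_coef_spin, (coframe_JT HL). ring. Qed.

Lemma smooth_azimuth_form i : smooth_at (fun q => mu q i) p.
Proof.
  assert (S := smooth_normal HL).
  unfold azimuth_form. smooth.
Qed.

Lemma smooth_coframe_coord i a : smooth_at (fun q => coframe kappa tau (f q) (push f (coord i) q) a) p.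
Proof. apply smooth_coframe; auto. intros k. now apply (smooth_push_coord kappa). Qed.

Lemma smooth_base_form i : smooth_at (fun q => om q i) p.
Proof. assert (S := smooth_coframe_coord). unfold base_form. smooth. Qed.

Lemma smooth_frame_form i : smooth_at (fun q => al q i) p.
Proof. assert (S := smooth_coframe_coord). assert (M := smooth_azimuth_form). assert (O := smooth_base_form). unfold frame_form. smooth. Qed.

End Oblique.

Section ObliqueEquations.
Context {kappa tau c : R} {f W : R * R -> vec3} {T J : R * R -> vec2} {p : R * R}.
Hypothesis HL : locally p (angle_at kappa tau c f W T J).
Hypothesis Hc : 1 - c * c <> 0.
Notation n q := (coframe kappa tau (f q) (W q)).
Notation xi X := (coframe kappa tau (f p) (push f X p)).
Notation g := (induced_metric kappa tau f).
Notation mu := (azimuth_form kappa tau c f W).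
Notation om := (base_form kappa tau f).
Notation nu q X := (normal_spin kappa tau c f W q X).
Notation al := (frame_form kappa tau c f W).
Notation lam := (shape_coef kappa tau c f W J).
Let Hn : immersed_near kappa f p := angle_immersed HL.
Let HD : in_bcv kappa (f p) := proj1 (immersed_near_at _ _ _ Hn).
Let Hf : forall k, smooth_at (fun q => f q k) p := proj1 (proj2 (immersed_near_at _ _ _ Hn)).
Let HLL : locally p (fun q => locally q (angle_at kappa tau c f W T J)) := locally_locally _ _ HL.
Let SM := smooth_azimuth_form HL.
Let SN := smooth_normal HL.
Let ST := smooth_T HL.
Let SJ := smooth_JT HL.

(** This formula contains no Christoffel symbols; it is the one that is
    differentiated below. *)
Lemma shape_coef_near : locally p (fun q => lam q = pair_form mu J q + kappa / 2 * (f q ix * n q ix + f q iy * n q iy)).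
Proof.
  generalize HLL. apply filter_imp. intros q Hq. rewrite (azimuth_form_JT Hq Hc). ring.
Qed.

Lemma smooth_pair_mu X : (forall i, smooth_at (fun q => X q i) p) -> smooth_at (pair_form mu X) p.
Proof. intros H. unfold pair_form, sum2. apply smooth_at_plus; apply smooth_at_mult; auto. Qed.

Lemma smooth_shape_coef : smooth_at lam p.
Proof.
  apply smooth_at_ext with (fun q => pair_form mu J q + kappa / 2 * (f q ix * n q ix + f q iy * n q iy)).
  - generalize shape_coef_near. apply filter_imp. auto.
  - assert (M := smooth_pair_mu J SJ). smooth.
Qed.

(** Up to the constant [1 - c^2] the exterior derivative is [2 dn_1 /\ dn_2], and
    [dn_1], [dn_2] are both multiples of [mu]. *)
Lemma azimuth_form_closed : d2 iu (fun q => mu q iv) p = d2 iv (fun q => mu q iu) p.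
Proof.
  assert (E : forall i j, d2 i (fun q => mu q j) p =
    (d2 i (fun q => n q ix) p * d2 j (fun q => n q iy) p + n p ix * d2 i (d2 j (fun q => n q iy)) p
    - (d2 i (fun q => n q iy) p * d2 j (fun q => n q ix) p + n p iy * d2 i (d2 j (fun q => n q ix)) p)) * / (1 - c * c)).
  { intros i j. unfold azimuth_form, Rdiv. rewrite d2_mult, d2_const, d2_minus, !d2_mult; smooth. ring. }
  assert (Ex : forall i, d2 i (fun q => n q ix) p = - n p iy * pair_form mu (coord i) p).
  { intros i. rewrite <- dir_deriv_coord. apply (deriv_normal_x HL Hc). }
  assert (Ey : forall i, d2 i (fun q => n q iy) p = n p ix * pair_form mu (coord i) p).
  { intros i. rewrite <- dir_deriv_coord. apply (deriv_normal_y HL Hc). }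
  rewrite !E, (d2_comm iu iv (fun q => n q ix)), (d2_comm iu iv (fun q => n q iy)) by auto.
  rewrite !Ex, !Ey. ring.
Qed.

Lemma bracket_T_JT k :
  dir_deriv T (fun q => J q k) p - dir_deriv J (fun q => T q k) p
  = 2 * tau * c * T p k - c * lam p * J p k.
Proof.
  rewrite <- (lc_bracket g T J p k (induced_metric_sym_near kappa tau f p)).
  rewrite (lc_T HL Hc), (lc_JT HL Hc).
  rewrite (frame_form_T HL Hc), (frame_form_JT HL Hc). ring.
Qed.

(** [d mu = 0] evaluated on [(T, JT)].  Both [mu(T)] and [mu(JT)] are explicit up to
    [lambda], so the only unknown derivative is [T[lambda]]. *)
Lemma codazzi : dir_deriv T lam p =
  - (lam p ^ 2 * c + kappa * c * (1 - c * c) + 4 * tau ^ 2 * c ^ 3).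
Proof.
  assert (E := exterior_derivative mu T J p ST SJ SM).
  rewrite azimuth_form_closed in E. unfold sum2 in E. rewrite !bracket_T_JT in E.
  rewrite (dir_deriv_ext T (pair_form mu J) (fun q => lam q - kappa / 2 * (f q ix * n q ix + f q iy * n q iy))) in E.
  2:{ generalize shape_coef_near. apply filter_imp. intros q Hq. rewrite Hq. ring. }
  rewrite (dir_deriv_ext J (pair_form mu T) (fun q => - 2 * tau * c * c + kappa * c / 2 * (f q iy * n q ix - f q ix * n q iy))) in E.
  2:{ generalize HLL. apply filter_imp. intros q Hq. apply (azimuth_form_T Hq Hc). }
  assert (SL := smooth_shape_coef).
  rewrite dir_deriv_minus, dir_deriv_mult, dir_deriv_const, dir_deriv_plus, !dir_deriv_mult in E; smooth.
  rewrite dir_deriv_plus, dir_deriv_const, dir_deriv_mult, dir_deriv_const, dir_deriv_minus, !dir_deriv_mult in E; smooth.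
  rewrite !(dir_deriv_x kappa tau f p HD), !(dir_deriv_y kappa tau f p HD) in E.
  rewrite !(coframe_T HL), !(coframe_JT HL) in E.
  rewrite !(deriv_normal_x HL Hc), !(deriv_normal_y HL Hc) in E.
  assert (B : forall r1 r2, (r1 * T p iu - r2 * J p iu) * mu p iu + (r1 * T p iv - r2 * J p iv) * mu p iv
    = r1 * pair_form mu T p - r2 * pair_form mu J p).
  { intros. unfold pair_form, sum2. ring. }
  rewrite B in E.
  rewrite (azimuth_form_T HL Hc), (azimuth_form_JT HL Hc) in E.
  unfold bcv_D in E. revert E.
  generalize (normal_xy HL).
  generalize (n p ix) (n p iy) (lam p) (dir_deriv T lam p) (f p ix) (f p iy).
  clear. intros n1 n2 L dL x y Q E.
  rewrite Rminus_diag in E by reflexivity.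
  (* [E] is d mu (T, JT) = 0; adding it to dL eliminates dL from the left-hand side *)
  match type of E with ?l = ?r => transitivity (dL + (l - r)); [rewrite E; ring|] end.
  rewrite <- Q. field.
Qed.

(** [alpha(T)] is constant and [alpha(JT) = c lambda], so that
    [d alpha (T, JT)] involves no other derivative than [T[lambda]]. *)
Lemma oblique_curvature : gauss_curv g p = (kappa - 4 * tau ^ 2) * c ^ 2.
Proof.
  assert (SL := smooth_shape_coef).
  assert (Hs : forall X Y, sum2 (fun i => sum2 (fun j => X p i * Y p j * g p i j)) = dot (xi X) (xi Y)).
  { intros X Y. rewrite <- (inner_push_push kappa tau f p X Y). now apply bcv_inner_coframe. }
  assert (K : gauss_curv g p * (1 - c * c) = - (dir_deriv T (pair_form al J) p - dir_deriv J (pair_form al T) p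
     + pair_form al T p ^ 2 + pair_form al J p ^ 2)).
  { assert (Q := normal_xy HL).
    apply gauss_curv_structure; auto.
    - intros i j. apply (smooth_induced_metric kappa tau f p Hn).
    - apply (induced_det_neq0 kappa tau f p Hn).
    - apply (induced_metric_sym_near kappa tau f p).
    - apply (smooth_frame_form HL).
    - generalize HLL. apply filter_imp. intros q Hq i k.
      rewrite (lc_T Hq Hc). unfold pair_form, sum2. destruct i; unfold coord; ring.
    - generalize HLL. apply filter_imp. intros q Hq i k.
      rewrite (lc_JT Hq Hc). unfold pair_form, sum2. destruct i; unfold coord; ring.
    - rewrite Hs. unfold dot, sum3. rewrite !(coframe_T HL).
      transitivity (c * c * (n p ix * n p ix + n p iy * n p iy) + (1 - c * c) * (1 - c * c)); [ring|].
      rewrite Q. ring.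
    - rewrite Hs. unfold dot, sum3. rewrite !(coframe_JT HL). rewrite <- Q. ring.
    - rewrite Hs. unfold dot, sum3. rewrite !(coframe_JT HL), !(coframe_T HL). ring. }
  rewrite (dir_deriv_ext T (pair_form al J) (fun q => c * lam q)) in K.
  2:{ generalize HLL. apply filter_imp. intros q Hq. apply (frame_form_JT Hq Hc). }
  rewrite (dir_deriv_ext J (pair_form al T) (fun q => - 2 * tau * c)) in K.
  2:{ generalize HLL. apply filter_imp. intros q Hq. apply (frame_form_T Hq Hc). }
  rewrite dir_deriv_const, dir_deriv_mult, dir_deriv_const, codazzi,
    (frame_form_T HL Hc), (frame_form_JT HL Hc) in K; smooth.
  apply (Rmult_eq_reg_r (1 - c * c)); auto. rewrite K. ring.
Qed.
End ObliqueEquations.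

(** * The horizontal case: the angle vanishes *)

(** The determinant of the differential, with respect to [e_1, e_2]. *)
Definition area (kappa tau : R) f q : R :=
  let th i a := coframe kappa tau (f q) (push f (coord i) q) a in
  th iu ix * th iv iy - th iv ix * th iu iy.

(** [lift_e1] and [lift_e2] are the columns of the inverse of that matrix, the
    fields with images [e_1] and [e_2]. *)
Definition lift_e1 (kappa tau : R) f q : vec2 := fun i =>
  let th j a := coframe kappa tau (f q) (push f (coord j) q) a in
  match i with iu => th iv iy | iv => - th iu iy end / area kappa tau f q.

Definition lift_e2 (kappa tau : R) f q : vec2 := fun i =>
  let th j a := coframe kappa tau (f q) (push f (coord j) q) a in
  match i with iu => - th iv ix | iv => th iu ix end / area kappa tau f q.

(** The connection form of the frame [e_1, e_2] once [tau = 0]. *)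
Definition horizontal_form (kappa tau : R) f q : vec2 := fun i => - base_form kappa tau f q i.

Section HorizontalPoint.
Context {kappa tau : R} {f W : R * R -> vec3} {T J : R * R -> vec2} {p : R * R}.
Hypothesis HL : locally p (angle_at kappa tau 1 f W T J).
Notation n q := (coframe kappa tau (f q) (W q)).
Notation xi X := (coframe kappa tau (f p) (push f X p)).
Notation g := (induced_metric kappa tau f).
Let Hn : immersed_near kappa f p := angle_immersed HL.
Let HD : in_bcv kappa (f p) := proj1 (immersed_near_at _ _ _ Hn).
Let Hf : forall k, smooth_at (fun q => f q k) p := proj1 (proj2 (immersed_near_at _ _ _ Hn)).

Lemma normal_horizontal : n p ix = 0 /\ n p iy = 0.
Proof.
  generalize (normal_xy HL). intros E.
  generalize (Rle_0_sqr (n p ix)) (Rle_0_sqr (n p iy)). unfold Rsqr. intros.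
  split; apply Rsqr_0_uniq; unfold Rsqr; lra.
Qed.

Lemma tangent_horizontal X : xi X iz = 0.
Proof.
  generalize (normal_tangent HL X). destruct normal_horizontal as [-> ->]. lra.
Qed.

End HorizontalPoint.

Section HorizontalFrame.
Context {kappa tau : R} {f W : R * R -> vec3} {T J : R * R -> vec2} {p : R * R}.
Hypothesis HL : locally p (angle_at kappa tau 1 f W T J).
Notation n q := (coframe kappa tau (f q) (W q)).
Notation xi X := (coframe kappa tau (f p) (push f X p)).
Notation g := (induced_metric kappa tau f).
Notation E1 := (lift_e1 kappa tau f).
Notation E2 := (lift_e2 kappa tau f).
Notation al0 := (horizontal_form kappa tau f).
Let Hn : immersed_near kappa f p := angle_immersed HL.
Let HD : in_bcv kappa (f p) := proj1 (immersed_near_at _ _ _ Hn).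
Let Hf : forall k, smooth_at (fun q => f q k) p := proj1 (proj2 (immersed_near_at _ _ _ Hn)).
Let HA : angle_at kappa tau 1 f W T J p := locally_singleton _ _ HL.
Let HW : forall k, smooth_at (fun r => W r k) p := proj1 (proj2 HA).
Let HLL : locally p (fun q => locally q (angle_at kappa tau 1 f W T J)) := locally_locally _ _ HL.

Lemma area_neq0 : area kappa tau f p <> 0.
Proof.
  intros Z. apply (induced_det_neq0 kappa tau f p Hn).
  transitivity (area kappa tau f p ^ 2); [|rewrite Z; ring].
  unfold det2, induced_metric. rewrite !bcv_inner_coframe by assumption. unfold dot, sum3.
  rewrite !(tangent_horizontal HL (coord _)). unfold area. ring.
Qed.

Lemma T_JT_zero i : T p i = 0 /\ J p i = 0.
Proof.
  assert (Z : forall a, coframe kappa tau (f p) (push f (fun _ _ => 0) p) a = 0).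
  { intros a. rewrite coframe_push. unfold sum2. ring. }
  destruct (normal_horizontal HL) as [N1 N2]. revert i.
  enough (H : (forall i, T p i = (fun _ _ => 0) p i) /\ (forall i, J p i = (fun _ _ => 0) p i)).
  { intros i. split; apply H. }
  split; [apply (push_inj kappa f p Hn T (fun _ _ => 0)) | apply (push_inj kappa f p Hn J (fun _ _ => 0))];
    apply (coframe_inj kappa tau (f p)); auto; intros a; rewrite Z.
  - rewrite (coframe_T HL). destruct a; rewrite ?N1, ?N2; ring.
  - rewrite (coframe_JT HL). destruct a; rewrite ?N1, ?N2; ring.
Qed.

Lemma normal_deriv_horizontal X a : dir_deriv X (fun q => n q a) p = 0.
Proof.
  rewrite (dir_deriv_ext X _ (fun _ => match a with iz => 1 | _ => 0 end)); [apply dir_deriv_const|].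
  generalize HLL. apply filter_imp. intros q Hq.
  destruct a; try apply (normal_horizontal Hq). apply (normal_z Hq).
Qed.

(** Here [S X = - tau X x e_3], so the second fundamental form is skew; being
    symmetric it vanishes, while [area] does not. *)
Lemma tau_zero : tau = 0.
Proof.
  generalize (second_form_sym HL (coord iu) (coord iv)).
  unfold dot, sum3. rewrite !coframe_conn by auto. rewrite !normal_deriv_horizontal.
  unfold frame_rot. rewrite !(tangent_horizontal HL (coord _)), (normal_z HL).
  destruct (normal_horizontal HL) as [-> ->]. intros E.
  destruct (Rmult_integral tau (area kappa tau f p)) as [H|H]; auto.
  - unfold area. lra.
  - now destruct area_neq0.
Qed.

Lemma smooth_lift_e1 i : smooth_at (fun q => E1 q i) p.
Proof.
  assert (S := smooth_coframe_coord HL). assert (N := area_neq0).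
  unfold lift_e1, area in *. destruct i; apply smooth_at_div; smooth.
Qed.
Lemma smooth_lift_e2 i : smooth_at (fun q => E2 q i) p.
Proof.
  assert (S := smooth_coframe_coord HL). assert (N := area_neq0).
  unfold lift_e2, area in *. destruct i; apply smooth_at_div; smooth.
Qed.

Lemma coframe_lift_e1 a : xi E1 a = match a with ix => 1 | _ => 0 end.
Proof.
  assert (N := area_neq0).
  destruct a; [| |apply (tangent_horizontal HL)]; rewrite coframe_push; unfold sum2, lift_e1;
  unfold area in *; field; auto.
Qed.

Lemma coframe_lift_e2 a : xi E2 a = match a with iy => 1 | _ => 0 end.
Proof.
  assert (N := area_neq0).
  destruct a; [| |apply (tangent_horizontal HL)]; rewrite coframe_push; unfold sum2, lift_e2;
  unfold area in *; field; auto.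
Qed.
End HorizontalFrame.

Section HorizontalConnection.
Context {kappa tau : R} {f W : R * R -> vec3} {T J : R * R -> vec2} {p : R * R}.
Hypothesis HL : locally p (angle_at kappa tau 1 f W T J).
Notation n q := (coframe kappa tau (f q) (W q)).
Notation xi X := (coframe kappa tau (f p) (push f X p)).
Notation g := (induced_metric kappa tau f).
Notation E1 := (lift_e1 kappa tau f).
Notation E2 := (lift_e2 kappa tau f).
Notation al0 := (horizontal_form kappa tau f).
Let Hn : immersed_near kappa f p := angle_immersed HL.
Let HD : in_bcv kappa (f p) := proj1 (immersed_near_at _ _ _ Hn).
Let Hf : forall k, smooth_at (fun q => f q k) p := proj1 (proj2 (immersed_near_at _ _ _ Hn)).
Let HA : angle_at kappa tau 1 f W T J p := locally_singleton _ _ HL.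
Let HW : forall k, smooth_at (fun r => W r k) p := proj1 (proj2 HA).
Let HLL : locally p (fun q => locally q (angle_at kappa tau 1 f W T J)) := locally_locally _ _ HL.

Lemma pair_horizontal_form X : pair_form al0 X p = - (kappa / 2 * (f p ix * xi X iy - f p iy * xi X ix)).
Proof. rewrite <- pair_base_form. unfold pair_form, horizontal_form, sum2. ring. Qed.

Lemma lc_lift_e1 X k : lc_conn g X E1 p k = pair_form al0 X p * E2 p k.
Proof.
  assert (SE := smooth_lift_e1 HL).
  apply (lc_conn_tangential_part kappa tau f p Hn X E1 (fun q i => pair_form al0 X p * E2 q i) (W p) 0 SE).
  - apply HA.
  - intros a. rewrite coframe_conn by (auto; intros; apply smooth_push; auto).
    (* e_1 has constant components, so only the rotation of the frame contributes *)
    rewrite (dir_deriv_ext X _ (fun q => match a with ix => 1 | _ => 0 end)), dir_deriv_const.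
    2:{ generalize HLL. apply filter_imp. intros q Hq. apply (coframe_lift_e1 Hq). }
    transitivity (pair_form al0 X p * xi E2 a + 0 * coframe kappa tau (f p) (W p) a).
    2:{ f_equal. rewrite !(coframe_push E2), (coframe_push (fun q i => pair_form al0 X p * E2 q i)). unfold sum2. ring. }
    rewrite (coframe_lift_e2 HL), pair_horizontal_form. unfold frame_rot.
    rewrite !(coframe_lift_e1 HL), (tau_zero HL).
    destruct a; ring.
Qed.

Lemma lc_lift_e2 X k : lc_conn g X E2 p k = - pair_form al0 X p * E1 p k.
Proof.
  assert (SE := smooth_lift_e2 HL).
  apply (lc_conn_tangential_part kappa tau f p Hn X E2 (fun q i => - pair_form al0 X p * E1 q i) (W p) 0 SE).
  - apply HA.
  - intros a. rewrite coframe_conn by (auto; intros; apply smooth_push; auto).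
    rewrite (dir_deriv_ext X _ (fun q => match a with iy => 1 | _ => 0 end)), dir_deriv_const.
    2:{ generalize HLL. apply filter_imp. intros q Hq. apply (coframe_lift_e2 Hq). }
    transitivity (- pair_form al0 X p * xi E1 a + 0 * coframe kappa tau (f p) (W p) a).
    2:{ f_equal. rewrite !(coframe_push E1), (coframe_push (fun q i => - pair_form al0 X p * E1 q i)). unfold sum2. ring. }
    rewrite (coframe_lift_e1 HL), pair_horizontal_form. unfold frame_rot.
    rewrite !(coframe_lift_e2 HL), (tau_zero HL).
    destruct a; ring.
Qed.

End HorizontalConnection.

Lemma horizontal_curvature {kappa tau f W T J p} :
  locally p (angle_at kappa tau 1 f W T J) ->
  gauss_curv (induced_metric kappa tau f) p = kappa.
Proof.
  intros HL. assert (Hn := angle_immersed HL).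
  assert (HD := proj1 (immersed_near_at _ _ _ Hn)).
  assert (Hf := proj1 (proj2 (immersed_near_at _ _ _ Hn))).
  assert (HLL := locally_locally _ _ HL). simpl in Hf.
  assert (Hs : forall X Y, sum2 (fun i => sum2 (fun j => X p i * Y p j * induced_metric kappa tau f p i j))
    = dot (coframe kappa tau (f p) (push f X p)) (coframe kappa tau (f p) (push f Y p))).
  { intros X Y. rewrite <- (inner_push_push kappa tau f p X Y). now apply bcv_inner_coframe. }
  assert (SO := smooth_base_form HL).
  rewrite <- (Rmult_1_r (gauss_curv _ _)).
  rewrite (gauss_curv_structure (induced_metric kappa tau f) (lift_e1 kappa tau f) (lift_e2 kappa tau f) (horizontal_form kappa tau f) 1 p).
  - rewrite (dir_deriv_ext _ (pair_form (horizontal_form kappa tau f) (lift_e2 kappa tau f)) (fun q => - (kappa / 2) * f q ix)).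
    2:{ generalize HLL. apply filter_imp. intros q Hq. rewrite pair_horizontal_form, !(coframe_lift_e2 Hq). ring. }
    rewrite (dir_deriv_ext _ (pair_form (horizontal_form kappa tau f) (lift_e1 kappa tau f)) (fun q => kappa / 2 * f q iy)).
    2:{ generalize HLL. apply filter_imp. intros q Hq. rewrite pair_horizontal_form, !(coframe_lift_e1 Hq). ring. }
    rewrite !dir_deriv_mult, !dir_deriv_const; smooth.
    rewrite !(dir_deriv_x kappa tau f p HD), !(dir_deriv_y kappa tau f p HD).
    rewrite !pair_horizontal_form, !(coframe_lift_e1 HL), !(coframe_lift_e2 HL).
    unfold bcv_D. field.
  - intros i j. apply (smooth_induced_metric kappa tau f p Hn).
  - apply (induced_det_neq0 kappa tau f p Hn).
  - apply (induced_metric_sym_near kappa tau f p).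
  - apply (smooth_lift_e1 HL).
  - apply (smooth_lift_e2 HL).
  - intros i. unfold horizontal_form. smooth.
  - generalize HLL. apply filter_imp. intros q Hq i k.
    rewrite (lc_lift_e1 Hq). unfold pair_form, sum2. destruct i; unfold coord; ring.
  - generalize HLL. apply filter_imp. intros q Hq i k.
    rewrite (lc_lift_e2 Hq). unfold pair_form, sum2. destruct i; unfold coord; ring.
  - lra.
  - rewrite Hs. unfold dot, sum3. rewrite !(coframe_lift_e1 HL). ring.
  - rewrite Hs. unfold dot, sum3. rewrite !(coframe_lift_e2 HL). ring.
  - rewrite Hs. unfold dot, sum3. rewrite !(coframe_lift_e1 HL), !(coframe_lift_e2 HL). ring.
Qed.

(** * From charts to the surface *)

Lemma constant_angle_chart kappa tau c f W T J p :
  locally p (angle_at kappa tau c f W T J) -> 0 <= c ->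
  let l := shape_coef kappa tau c f W J in
  let S := shape kappa tau f W in
  let g := induced_metric kappa tau f in
  let nabla := lc_conn g in
  smooth_at l p /\
  ((forall k, S T p k = - tau * push f J p k) /\
   (forall k, S J p k = - tau * push f T p k + l p * push f J p k)) /\
  ((forall a, nabla T T p a = - 2 * tau * c * J p a) /\
   (forall a, nabla J T p a = l p * c * J p a) /\
   (forall a, nabla T J p a = 2 * tau * c * T p a) /\
   (forall a, nabla J J p a = - l p * c * T p a)) /\
  gauss_curv g p = (kappa - 4 * tau ^ 2) * c ^ 2 /\
  dir_deriv T l p + l p ^ 2 * c + kappa * c * (1 - c * c) + 4 * tau ^ 2 * c ^ 3 = 0.
Proof.
  intros HL Hc l S g nabla.
  destruct (Req_dec (1 - c * c) 0) as [H0|H0].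
  - assert (C : c = 1).
    { assert (E : (c - 1) * (c + 1) = 0) by (rewrite <- (Ropp_0), <- H0; ring).
      destruct (Rmult_integral _ _ E); lra. }
    subst c.
    assert (Z := fun i => proj1 (T_JT_zero HL i)).
    assert (ZJ := fun i => proj2 (T_JT_zero HL i)).
    assert (T0 := tau_zero HL).
    assert (L0 : locally p (fun q => 0 = l q)).
    { generalize (locally_locally _ _ HL). apply filter_imp. intros q Hq.
      assert (ZJq := fun i => proj2 (T_JT_zero Hq i)).
      unfold l, shape_coef. rewrite inner_push. unfold sum2. rewrite !ZJq. unfold Rdiv. ring. }
    assert (Lp : 0 = l p) by exact (locally_singleton _ _ L0).
    assert (P : forall X, (forall i, X p i = 0) -> forall k, push f X p k = 0).
    { intros X HX k. unfold push, sum2. rewrite !HX. ring. }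
    assert (Sh : forall X, (forall i, X p i = 0) -> forall k, S X p k = 0).
    { intros X HX k. unfold S, shape. rewrite conn_dir. unfold sum2. rewrite !HX. ring. }
    assert (Nb : forall X Y, (forall i, X p i = 0) -> forall k, nabla X Y p k = 0).
    { intros X Y HX k. unfold nabla. rewrite lc_dir. unfold sum2. rewrite !HX. ring. }
    split; [|split; [|split; [|split]]].
    + apply (smooth_at_ext _ _ _ L0), smooth_at_const.
    + split; intros k; rewrite Sh, ?(P T), ?(P J) by assumption; ring.
    + repeat split; intros a; rewrite Nb, ?Z, ?ZJ by assumption; ring.
    + unfold g. rewrite (horizontal_curvature HL), T0. ring.
    + rewrite <- (dir_deriv_ext T _ _ p L0), dir_deriv_const, <- Lp, T0. ring.
  - assert (HD : in_bcv kappa (f p)) by now destruct (locally_singleton _ _ HL) as [[H _] _].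
    assert (LN : l p = normal_spin kappa tau c f W p J) by exact (shape_coef_spin HL H0).
    assert (AT := frame_form_T HL H0).
    assert (AJ := frame_form_JT HL H0). fold l in AJ.
    split; [|split; [|split; [|split]]].
    + apply (smooth_shape_coef HL H0).
    + split; apply (coframe_inj kappa tau (f p)); auto; intros a; unfold S;
      rewrite (coframe_shape HL H0).
      * rewrite (coframe_scal kappa tau f p (- tau) (push f J p)), (normal_spin_T HL H0).
        rewrite !(coframe_T HL), !(coframe_JT HL).
        destruct a; ring.
      * rewrite (coframe_plus kappa tau f p (fun k => - tau * push f T p k) (fun k => l p * push f J p k)).
        rewrite (coframe_scal kappa tau f p (- tau) (push f T p)), (coframe_scal kappa tau f p (l p) (push f J p)), <- LN.
        rewrite !(coframe_T HL), !(coframe_JT HL).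
        generalize (normal_xy HL). intros Q.
        destruct a; try rewrite <- Q; ring.
    + repeat split; intros a; unfold nabla, g;
       rewrite ?(lc_T HL H0), ?(lc_JT HL H0), ?AT, ?AJ; ring.
    + apply (oblique_curvature HL H0).
    + unfold l. rewrite (codazzi HL H0). ring.
Qed.

(** The chain rule carries [JT] in the first chart to a field with the same image;
    by injectivity of the differential that is [JT] in the second chart. *)
Lemma shape_coef_chart_change kappa tau c (fi fj Wi Wj : R * R -> vec3) (Ti Tj Ji Jj : R * R -> vec2)
   (psi : R * R -> R * R) p :
  locally p (angle_at kappa tau c fi Wi Ti Ji) ->
  locally (psi p) (angle_at kappa tau c fj Wj Tj Jj) ->
  smooth_at (fun r => fst (psi r)) p -> smooth_at (fun r => snd (psi r)) p ->
  locally p (fun r => fj (psi r) = fi r) -> locally p (fun r => Wj (psi r) = Wi r) ->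
  shape_coef kappa tau c fi Wi Ji p = shape_coef kappa tau c fj Wj Jj (psi p).
Proof.
  intros Hi Hj S1 S2 Ef EW.
  assert (Ef0 := locally_singleton _ _ Ef). assert (EW0 := locally_singleton _ _ EW). simpl in Ef0, EW0.
  set (X' := fun (_ : R * R) (b : ix2) => match b with
    | iu => dir_deriv Ji (fun r => fst (psi r)) p
    | iv => dir_deriv Ji (fun r => snd (psi r)) p end).
  assert (C : forall h hj : R * R -> R, locally p (fun r => hj (psi r) = h r) -> smooth_at hj (psi p) ->
    dir_deriv Ji h p = dir_deriv X' hj (psi p)).
  { intros h hj E S. rewrite <- (dir_deriv_ext Ji _ _ _ E).
    unfold X', dir_deriv, sum2. rewrite !(d2_comp _ hj psi p) by assumption. ring. }
  assert (Ai := locally_singleton _ _ Hi). assert (Aj := locally_singleton _ _ Hj). simpl in Ai, Aj.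
  destruct Ai as ((Di & Sfi & _) & SWi & _ & _ & _ & PTi & PJi).
  destruct Aj as ((Dj & Sfj & Inj) & SWj & _ & _ & _ & PTj & PJj).
  assert (EP : forall k, push fi Ji p k = push fj X' (psi p) k).
  { intros k. rewrite !push_dir. apply C; auto. revert Ef. apply filter_imp. intros r E. now rewrite E. }
  assert (ET : forall k, push fi Ti p k = push fj Tj (psi p) k).
  { intros k. generalize (PTi k) (PTj k). rewrite Ef0, EW0. lra. }
  assert (EJ : forall k, push fi Ji p k = push fj Jj (psi p) k).
  { intros k. rewrite PJi, PJj, Ef0, EW0. unfold bcv_cross, bcv_inner, sum3. now rewrite !ET. }
  assert (EX : forall a, X' (psi p) a = Jj (psi p) a).
  { apply (push_inj kappa fj (psi p) (angle_immersed Hj)).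
    intros k. now rewrite <- EP, EJ. }
  assert (ES : forall k, shape kappa tau fi Wi Ji p k = shape kappa tau fj Wj Jj (psi p) k).
  { intros k. unfold shape. f_equal. unfold bcv_conn, sum3. rewrite !EJ, Ef0, EW0. f_equal.
    rewrite (C _ (fun q => Wj q k)); auto.
    - unfold dir_deriv, sum2. now rewrite !EX.
    - revert EW. apply filter_imp. intros r E. now rewrite E. }
  unfold shape_coef. rewrite Ef0. f_equal. unfold bcv_inner, sum3. now rewrite !ES, !EJ.
Qed.

Theorem lemma4 (kappa tau : R) (htau : 0 <= tau)
    (M : surface) (F N : M -> vec3) (theta : R)
    (hF : bcv_immersion kappa M F)
    (hN : unit_normal kappa tau M F N)
    (htheta : constant_angle kappa tau M F N theta)
    (T JT : tangent_field M)
    (hT : is_e3_projection kappa tau M F N theta T)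
    (hJT : is_rotation kappa tau M F N T JT) :
  exists lambda : M -> R, smooth_fun M lambda /\
    forall (i : idx M) (p : R * R), dom M i p ->
      let f := in_chart i F in
      let l := in_chart i lambda in
      let S := shape kappa tau f (in_chart i N) in
      let g := induced_metric kappa tau f in
      let nabla := lc_conn g in
      ((forall k, S (T i) p k = - tau * push f (JT i) p k) /\
       (forall k, S (JT i) p k = - tau * push f (T i) p k + l p * push f (JT i) p k)) /\
      ((forall a, nabla (T i) (T i) p a = - 2 * tau * cos theta * JT i p a) /\
       (forall a, nabla (JT i) (T i) p a = l p * cos theta * JT i p a) /\
       (forall a, nabla (T i) (JT i) p a = 2 * tau * cos theta * T i p a) /\
       (forall a, nabla (JT i) (JT i) p a = - l p * cos theta * T i p a)) /\
      gauss_curv g p = (kappa - 4 * tau ^ 2) * cos theta ^ 2 /\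
      dir_deriv (T i) l p + l p ^ 2 * cos theta + kappa * cos theta * sin theta ^ 2
        + 4 * tau ^ 2 * cos theta ^ 3 = 0.
Proof.
  assert (HL : forall (i : idx M) p, dom M i p ->
    locally p (angle_at kappa tau (cos theta) (in_chart i F) (in_chart i N) (T i) (JT i))).
  { intros i p Hp. generalize (dom_open M i p Hp). apply filter_imp. intros q Hq.
    destruct hF as (F1 & F2 & F3). destruct hN as (N1 & N2 & N3).
    repeat split.
    - apply F1.
    - intros k. now apply (F2 k).
    - exact (F3 i q Hq).
    - intros k. now apply (N1 k).
    - apply N2.
    - now apply N3.
    - apply htheta.
    - intros k. now apply hT.
    - intros k. now apply hJT. }
  set (L := fun i : idx M => shape_coef kappa tau (cos theta) (in_chart i F) (in_chart i N) (JT i)).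
  destruct (functional_choice (fun (x : M) (ip : idx M * (R * R)) =>
     dom M (fst ip) (snd ip) /\ chart M (fst ip) (snd ip) = x)) as [sel Hsel].
  { intros x. destruct (chart_cover M x) as (i & p & H). now exists (i, p). }
  set (lambda := fun x => L (fst (sel x)) (snd (sel x))).
  assert (E : forall (i : idx M) p, dom M i p -> L i p = in_chart i lambda p).
  { intros i p Hp. unfold in_chart, lambda. destruct (Hsel (chart M i p)) as [Hq Eq].
    set (j := fst (sel (chart M i p))) in *. set (q := snd (sel (chart M i p))) in *.
    destruct (chart_change M i j p q Hp Hq (eq_sym Eq)) as (psi & H & S1 & S2 & _).
    destruct (locally_singleton _ _ H) as [Dq Cq].
    assert (Q : psi p = q) by (apply (chart_inj M j); auto; now rewrite Cq).
    rewrite <- Q.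
    apply (shape_coef_chart_change kappa tau (cos theta) _ _ _ _ (T i) (T j) (JT i) (JT j) psi p); auto;
      unfold in_chart; revert H; apply filter_imp; intros r [_ Er]; now rewrite Er. }
  assert (EL : forall (i : idx M) p, dom M i p -> locally p (fun q => L i q = in_chart i lambda q)).
  { intros i p Hp. generalize (dom_open M i p Hp). apply filter_imp. intros q Hq. now apply E. }
  assert (Hc : 0 <= cos theta).
  { destruct htheta as [[H1 H2] _]. apply cos_ge_0; lra. }
  assert (Main := fun (i : idx M) p Hp => constant_angle_chart kappa tau (cos theta) _ _ _ _ p (HL i p Hp) Hc).
  exists lambda. split.
  - intros i p Hp. apply (smooth_at_ext (L i)); [exact (EL i p Hp)|]. apply (Main i p Hp).
  - intros i p Hp f l S g nabla. destruct (Main i p Hp) as (_ & I & II & III & IV).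
    fold (L i) in *. unfold l in *. rewrite <- (E i p Hp).
    split; [exact I | split; [exact II | split; [exact III |]]].
    rewrite <- (dir_deriv_ext (T i) _ _ p (EL i p Hp)).
    transitivity (dir_deriv (T i) (L i) p + L i p ^ 2 * cos theta
      + kappa * cos theta * (1 - cos theta * cos theta) + 4 * tau ^ 2 * cos theta ^ 3); [|exact IV].
    generalize (sin2 theta). unfold Rsqr. intros Es.
    replace (sin theta ^ 2) with (1 - cos theta * cos theta) by (rewrite <- Es; ring). ring.
Qed.
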